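(* Let $a\in\mathcal{H}$ have polynomial growth and suppose that $|a(x)-cp(x)|\to\infty$ as $x\to\infty$ for every $p\in\mathbb{Z}[x]$ and $c\in\mathbb{R}$. Then every $\Lambda\subset\mathbb{Z}$ with $\bar d(\Lambda)>0$ contains $x,y\in\Lambda$ that satisfy $y-x=[a(n)]$ for some $n\in\mathbb{N}$ with $[a(n)]\neq 0$.
   Context: $\mathbb{N}=\{1,2,\ldots\}$; $[x]$ is the integer part of $x$. The upper density of $\Lambda\subset\mathbb{Z}$ is $\bar d(\Lambda)=\limsup_{N\to\infty}|\Lambda\cap\{-N,\ldots,N\}|/(2N+1)$. Hardy fields: let $B$ be the ring (pointwise operations) of equivalence classes of real valued functions defined on some half line $(u,\infty)$, two functions being identified if they agree for all large $x$. A Hardy field is a subfield of $(B,+,\cdot)$ that is closed under differentiation. $\mathcal{H}$ denotes the union of all Hardy fields. Elements of $\mathcal{H}$ are treated as functions; all statements about them concern sufficiently large $x$, and $a(n)$ is considered only for those $n$ for which it is defined. The function $a$ has polynomial growth if $a(x)/x^d\to 0$ as $x\to\infty$ for some $d\in\mathbb{N}$. *)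

(* Defs.v *)
From HB Require Import structures.
From mathcomp Require Import all_boot all_order all_algebra.
From mathcomp Require Import finmap.
From mathcomp Require Import all_classical all_reals all_analysis.

Set Implicit Arguments.
Unset Strict Implicit.
Unset Printing Implicit Defensive.

Import Order.TTheory GRing.Theory Num.Theory.
Import numFieldNormedType.Exports.

Local Open Scope classical_set_scope.
Local Open Scope ring_scope.

(* A germ at +oo is represented by any total function extending one of its
   representatives; two functions represent the same element of the ring B of
   germs iff they agree eventually. *)
Definition germ_eq (R : realType) (f g : R -> R) : Prop :=
  \forall x \near +oo, f x = g x.

(* A set of germs is represented by a set of functions saturated for [germ_eq];
   the remaining fields say that this set of germs is a subfield of B closed
   under differentiation. In [hardy_derive], [derive1 f] is junk where [f] is not
   derivable, which is harmless since [f] is eventually derivable and [H] is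
   saturated. *)
Record is_hardy_field (R : realType) (H : set (R -> R)) : Prop := IsHardyField {
  hardy_germ : forall f g, germ_eq f g -> H f -> H g;
  hardy_one : H (fun=> 1);
  hardy_sub : forall f g, H f -> H g -> H (f \- g);
  hardy_mul : forall f g, H f -> H g -> H (f \* g);
  hardy_inv : forall f, H f -> ~ germ_eq f (fun=> 0) ->
    exists2 g, H g & germ_eq (f \* g) (fun=> 1);
  hardy_derive : forall f, H f ->
    (\forall x \near +oo, derivable f x 1) /\ H (derive1 f)
}.

Definition hardy_union (R : realType) : set (R -> R) :=
  \bigcup_(H in @is_hardy_field R) H.

Definition polynomial_growth (R : realType) (a : R -> R) : Prop :=
  exists2 d : nat, (0 < d)%N & a x / x ^+ d @[x --> +oo] --> 0.

Definition upper_density (R : realType) (L : set int) : \bar R :=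
  limn_esup (fun N : nat =>
    (#|` fset_set (L `&` [set k : int | - N%:Z <= k <= N%:Z]) |%:R
       / (2 * N + 1)%:R)%:E).
Arguments upper_density R L : clear implicits.

(* Main.v *)
(* A set of integers d(n) meets the difference set of every set of positive upper
   density as soon as weighted averages of exp (2 i pi theta d(n)) have, for each
   fixed theta in [0, 1], real part eventually above any given negative number:
   if the differences d(n) were avoided, the spectral measures of the set on long
   windows would annihilate these averages, so that a limit of them, which has
   an atom at 0, would give mass bounded below to every set where an average is
   very negative, and some theta would belong to infinitely many of these sets.

   To pass from d(n) = [a(n)] to a(n) the averages are weighted by a Fejer kernel
   centred at the n with fractional part of a(n) near 1/2. It remains to find
   weights w such that the averages of exp (2 i pi theta a(n)) tend to 0 for every
   real theta <> 0. Some difference of a(n) tends monotonically to 0; subtracting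
   a real polynomial P, one gets a = P + e where either e -> 0, or some difference
   b of e tends to infinity while its increments decrease to 0. In the first case
   w = 1 works, since theta P has an irrational nonconstant coefficient. In the
   second case w(n) is the increment of b at n, so that b is spread evenly over
   long intervals: van der Corput differencing reduces theta a to a polynomial
   plus a multiple of b, for which the averages vanish whatever the polynomial. *)
Require Import Defs.
From HB Require Import structures.
From mathcomp Require Import all_boot all_order all_algebra.
From mathcomp Require Import finmap.
From mathcomp Require Import all_classical all_reals all_analysis.
From mathcomp Require Import ring lra zify.

Set Implicit Arguments.
Unset Strict Implicit.
Unset Printing Implicit Defensive.

Import Order.TTheory GRing.Theory Num.Theory.
Import numFieldNormedType.Exports.

Local Open Scope classical_set_scope.
Local Open Scope ring_scope.

Lemma cvgD0 {R : realType} {T : Type} (F : set_system T) {FF : Filter F}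
    (f g : T -> R) :
  f x @[x --> F] --> 0 -> g x @[x --> F] --> 0 -> f x + g x @[x --> F] --> 0.
Proof. by move=> f0 g0; rewrite -[0 in X in _ --> X](addr0 0); exact: cvgD. Qed.

Lemma cvgZ0 {R : realType} {T : Type} (F : set_system T) {FF : Filter F}
    (c : R) (f : T -> R) :
  f x @[x --> F] --> 0 -> c * f x @[x --> F] --> 0.
Proof. by move=> f0; rewrite -[0 in X in _ --> X](mulr0 c); exact: cvgMr. Qed.

(** * Averages with nonincreasing weights of divergent sum *)

Section WeightedAverages.
Context {R : realType}.
Implicit Types (w u v f : nat -> R) (N n h q : nat).

Definition avg w u N : R :=
  (\sum_(n < N) w n * u n) / (\sum_(n < N) w n).

(** Monotonicity serves Abel summation; divergence makes every bounded numerator negligible in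
    [avg]. *)
Record weight w : Prop := Weight {
  weight_ge0 : forall n, 0 <= w n;
  weight_noninc : forall n, w n.+1 <= w n;
  weight_divergent : \sum_(n < N) w n @[N --> \oo] --> +oo }.

Lemma avgD w u v N : avg w (fun n => u n + v n) N = avg w u N + avg w v N.
Proof. by rewrite /avg -mulrDl -big_split; congr (_ / _); apply: eq_bigr => i _; rewrite mulrDr. Qed.

Lemma avgZ w c u N : avg w (fun n => c * u n) N = c * avg w u N.
Proof. by rewrite /avg mulrA mulr_sumr; congr (_ / _); apply: eq_bigr => i _; rewrite mulrCA. Qed.

Lemma avgB w u v N : avg w (fun n => u n - v n) N = avg w u N - avg w v N.
Proof.
rewrite -mulN1r -avgZ -avgD; congr (avg _ _ _); apply/funext => n.
by rewrite mulN1r.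
Qed.

Lemma avg_sum w (I : Type) (r : seq I) (F : I -> nat -> R) N :
  avg w (fun n => \sum_(i <- r) F i n) N = \sum_(i <- r) avg w (F i) N.
Proof.
elim: r => [|i r IH]; first by rewrite big_nil /avg big1 ?mul0r// => n _; rewrite big_nil mulr0.
rewrite big_cons -IH -avgD; congr (avg _ _ _); apply/funext => n.
by rewrite big_cons.
Qed.

Section Weight.
Context (w : nat -> R) (w_wt : weight w).

Let w_ge0 n : 0 <= w n := weight_ge0 w_wt n.

Lemma weight_noninc_le m n : (m <= n)%N -> w n <= w m.
Proof.
move=> /subnKC <-; elim: (n - m)%N => [|k IH]; first by rewrite addn0.
by rewrite addnS; apply: le_trans IH; exact: weight_noninc.
Qed.

Lemma weight_sum_ge0 N : 0 <= \sum_(n < N) w n.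
Proof. by apply: sumr_ge0 => i _. Qed.

Lemma le_avg u v N : (forall n, u n <= v n) -> avg w u N <= avg w v N.
Proof.
move=> uv; rewrite /avg ler_wpM2r ?invr_ge0 ?weight_sum_ge0//.
by apply: ler_sum => i _; rewrite ler_wpM2l.
Qed.

Lemma avg_ge0 u N : (forall n, 0 <= u n) -> 0 <= avg w u N.
Proof.
move=> u0; rewrite /avg mulr_ge0 ?invr_ge0 ?weight_sum_ge0//.
by apply: sumr_ge0 => i _; rewrite mulr_ge0.
Qed.

Lemma ler_norm_avg u N : `|avg w u N| <= avg w (fun n => `|u n|) N.
Proof.
rewrite /avg normrM normfV (ger0_norm (weight_sum_ge0 _)).
rewrite ler_wpM2r ?invr_ge0 ?weight_sum_ge0//.
apply: le_trans (ler_norm_sum _ _ _) _.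
by apply: ler_sum => i _; rewrite normrM (ger0_norm (w_ge0 _)).
Qed.

Lemma avg_cst c N : 0 < \sum_(n < N) w n -> avg w (fun=> c) N = c.
Proof. by move=> W0; rewrite /avg -mulr_suml mulrAC divff ?mul1r ?gt_eqF. Qed.

Lemma near_weight_sum_gt0 : \forall N \near \oo, 0 < \sum_(n < N) w n.
Proof. by apply: (cvgryPgt _).1; exact: weight_divergent. Qed.

Lemma cvg_avg_cst c : avg w (fun=> c) N @[N --> \oo] --> c.
Proof.
apply: cvg_near_cst; near=> N; apply: avg_cst.
by near: N; exact: near_weight_sum_gt0.
Unshelve. all: by end_near. Qed.

Lemma cvg_avg_bounded_sum u C :
  (forall N, `|\sum_(n < N) w n * u n| <= C) -> avg w u N @[N --> \oo] --> 0.
Proof.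
move=> uC; apply/cvgr0Pnorm_le => e e0; near=> N.
have W0 : 0 < \sum_(n < N) w n by near: N; exact: near_weight_sum_gt0.
rewrite /avg normrM normfV (gtr0_norm W0) ler_pdivrMr// (le_trans (uC N))//.
rewrite -ler_pdivrMl//; near: N.
by apply: (cvgryPge _).1; exact: weight_divergent.
Unshelve. all: by end_near. Qed.

(* Abel summation: since [w] is monotone, shifting [u] changes the sum by at
   most a boundary term. *)
Lemma cvg_avg_shift u C h : (forall n, `|u n| <= C) ->
  avg w (fun n => u (n + h)%N) N - avg w u N @[N --> \oo] --> 0.
Proof.
move=> uC; elim: h => [|h IH].
  rewrite [X in X @ _ --> _](_ : _ = fun=> 0); first exact: cvg_cst.
  by apply/funext => N; rewrite -avgB /avg big1 ?mul0r// => i _; rewrite addn0 subrr mulr0.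
rewrite [X in X @ _ --> _](_ : _ = fun N =>
  (avg w (fun n => u (n + h).+1 - u (n + h)%N) N) +
  (avg w (fun n => u (n + h)%N) N - avg w u N)); last first.
  by apply/funext => N; under [in LHS]eq_fun do rewrite addnS; rewrite avgB; ring.
apply: cvgD0 => //.
have C0 : 0 <= C by rewrite (le_trans _ (uC 0%N)).
apply: (@cvg_avg_bounded_sum _ (2 * C * w 0%N)) => N.
pose v n := u (n + h)%N.
have -> : \sum_(n < N) w n * (u (n + h).+1 - u (n + h)%N) =
  w N * v N - w 0%N * v 0%N + \sum_(n < N) (w n - w n.+1) * v n.+1.
  elim: N => [|N IHN]; first by rewrite !big_ord0; ring.
  by rewrite !big_ord_recr/= IHN /v addSn; ring.
have vC n : `|v n| <= C by exact: uC.
have S : `|\sum_(n < N) (w n - w n.+1) * v n.+1| <= C * (w 0%N - w N).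
  apply: le_trans (ler_norm_sum _ _ _) _.
  have -> : C * (w 0%N - w N) = \sum_(n < N) (w n - w n.+1) * C.
    elim: N => [|N IHN]; first by rewrite big_ord0 subrr mulr0.
    by rewrite big_ord_recr/= -IHN; ring.
  apply: ler_sum => i _; rewrite normrM ger0_norm ?subr_ge0 ?weight_noninc//.
  by rewrite ler_wpM2l// subr_ge0 weight_noninc.
apply: le_trans (ler_normD _ _) _; apply: le_trans (lerD (ler_normB _ _) S) _.
rewrite !normrM !(ger0_norm (w_ge0 _)).
have a1 := ler_wpM2l (w_ge0 N) (vC N).
have a2 := ler_wpM2l (w_ge0 0%N) (vC 0%N).
nra.
Qed.

(** The terms before some [M] contribute a fixed amount [D], negligible against the total weight;
    the later ones are uniformly small. *)
Lemma cvg_avg0 u : u n @[n --> \oo] --> 0 -> avg w u N @[N --> \oo] --> 0.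
Proof.
move=> u0; apply/cvgr0Pnorm_le => e e0.
have e20 : 0 < e / 2 by rewrite divr_gt0.
have [M _ uM] : \forall n \near \oo, `|u n| <= e / 2 by move/cvgr0Pnorm_le : u0; exact.
pose D := \sum_(n < M) w n * `|u n|.
have bnd k : \sum_(n < M + k) w n * `|u n| <=
    D + e / 2 * \sum_(n < M + k) w n.
  elim: k => [|k IH].
    by rewrite addn0 lerDl mulr_ge0 ?weight_sum_ge0// ltW.
  rewrite addnS !big_ord_recr/=.
  have := ler_wpM2l (w_ge0 (M + k)%N) (uM (M + k)%N (leq_addr _ _)).
  lra.
near=> N.
have W0 : 0 < \sum_(n < N) w n by near: N; exact: near_weight_sum_gt0.
rewrite (le_trans (ler_norm_avg _ _))// /avg ler_pdivrMr//.
have MN : (M <= N)%N by near: N; exact: nbhs_infty_ge.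
rewrite -(subnKC MN) (le_trans (bnd _))// subnKC//.
suff : D <= e / 2 * \sum_(n < N) w n by lra.
rewrite -ler_pdivrMl//; near: N.
by apply: (cvgryPge _).1; exact: weight_divergent.
Unshelve. all: by end_near. Qed.

Lemma cvg_avg_near u v : (u n - v n) @[n --> \oo] --> 0 ->
  avg w v N @[N --> \oo] --> 0 -> avg w u N @[N --> \oo] --> 0.
Proof.
move=> uv v0; rewrite (_ : u = (fun n => (u n - v n) + v n)); last first.
  by apply/funext => n; rewrite subrK.
under eq_fun do rewrite avgD.
by apply: cvgD0 => //; exact: cvg_avg0.
Qed.

(** The variance of [u] is nonnegative. *)
Lemma sqr_avg_le u N : 0 < \sum_(n < N) w n ->
  avg w u N ^+ 2 <= avg w (fun n => u n ^+ 2) N.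
Proof.
move=> W0; set m := avg w u N.
have : 0 <= avg w (fun n => (u n - m) ^+ 2) N by apply: avg_ge0 => n; rewrite sqr_ge0.
rewrite (_ : (fun n => _) = (fun n => (u n ^+ 2 - (2 * m) * u n) + m ^+ 2)); last first.
  by apply/funext => n; ring.
rewrite avgD avgB avgZ avg_cst// -/m; nra.
Qed.

End Weight.
End WeightedAverages.

(** * Real and imaginary parts of exp (2 i pi x) *)

Section UnitCircle.
Context {R : realType}.
Implicit Types (x y z d : R) (k : int).

Definition ecos x : R := cos (2 * pi * x).
Definition esin x : R := sin (2 * pi * x).

Lemma MVT_any (f df : R -> R) x y : (forall z, is_derive z 1 f (df z)) ->
  exists2 z, `|z - x| <= `|y - x| & f y - f x = df z * (y - x).
Proof.
move=> fdf.
have fc a b : {within `[a, b], continuous f}.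
  apply: continuous_subspaceT => z; apply/differentiable_continuous/derivable1_diffP.
  by case: (fdf z).
have [xy|yx|->] := ltgtP x y; last by exists y; rewrite ?subrr ?mulr0.
- have [z zxy E] := MVT xy (fun z _ => fdf z) (@fc x y).
  exists z => //; move: zxy; rewrite in_itv/= => /andP[xz zy].
  by rewrite !ger0_norm ?subr_ge0 ?ltW//; lra.
- have [z zxy E] := MVT yx (fun z _ => fdf z) (@fc y x).
  exists z; last by rewrite -opprB E -mulrN opprB.
  move: zxy; rewrite in_itv/= => /andP[xz zy].
  by rewrite !ler0_norm ?subr_le0 ?ltW//; lra.
Qed.

Lemma ler_dist_cos x y : `|cos x - cos y| <= `|x - y|.
Proof.
have [z _ ->] := MVT_any y x (@is_derive_cos R).
by rewrite normrM normrN ler_piMl// sin_max.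
Qed.

Lemma ler_dist_sin x y : `|sin x - sin y| <= `|x - y|.
Proof.
have [z _ ->] := MVT_any y x (@is_derive_sin R).
by rewrite normrM ler_piMl// cos_max.
Qed.

Lemma cos_taylor1 x d : `|cos (x + d) - cos x + d * sin x| <= d ^+ 2.
Proof.
have [z zx] := MVT_any x (x + d) (@is_derive_cos R).
move: zx; rewrite addrAC subrr add0r => zx ->.
rewrite (_ : _ + _ = d * (sin x - sin z)); last by ring.
rewrite normrM -[leRHS](ger0_norm (sqr_ge0 d)) normrX expr2 ler_wpM2l//.
by rewrite (le_trans (ler_dist_sin _ _))// distrC.
Qed.

Lemma trigD2pin x n : cos (x + 2 * pi * n%:R) = cos x /\ sin (x + 2 * pi * n%:R) = sin x.
Proof.
elim: n => [|n [cE sE]]; first by rewrite mulr0 addr0.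
have -> : x + 2 * pi * n.+1%:R = x + 2 * pi * n%:R + pi *+ 2.
  by rewrite -[pi *+ 2]mulr_natl -natr1; ring.
by rewrite cosD2pi sinD2pi.
Qed.

Lemma ecos_addz x k : ecos (x + k%:~R) = ecos x.
Proof.
rewrite /ecos mulrDr; case: (intP k) => [|n|n].
- by rewrite mulr0 addr0.
- by have [] := trigD2pin (2 * pi * x) n.+1.
- have [<- _] := trigD2pin (2 * pi * x + 2 * pi * (- (n.+1)%:Z)%:~R) n.+1.
  by rewrite mulrNz; congr cos; ring.
Qed.

Lemma esin_addz x k : esin (x + k%:~R) = esin x.
Proof.
rewrite /esin mulrDr; case: (intP k) => [|n|n].
- by rewrite mulr0 addr0.
- by have [] := trigD2pin (2 * pi * x) n.+1.
- have [_ <-] := trigD2pin (2 * pi * x + 2 * pi * (- (n.+1)%:Z)%:~R) n.+1.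
  by rewrite mulrNz; congr sin; ring.
Qed.

Lemma ecosD x y : ecos (x + y) = ecos x * ecos y - esin x * esin y.
Proof. by rewrite /ecos mulrDr cosD. Qed.
Lemma esinD x y : esin (x + y) = esin x * ecos y + ecos x * esin y.
Proof. by rewrite /esin mulrDr sinD. Qed.
Lemma ecosB x y : ecos (x - y) = ecos x * ecos y + esin x * esin y.
Proof. by rewrite /ecos mulrBr cosB. Qed.
Lemma ecosM x y : ecos x * ecos y = (ecos (x + y) + ecos (x - y)) / 2.
Proof. by rewrite ecosD ecosB; field. Qed.
Lemma ecosN x : ecos (- x) = ecos x.
Proof. by rewrite /ecos mulrN cosN. Qed.
Lemma ecos0 : ecos 0 = 1. Proof. by rewrite /ecos mulr0 cos0. Qed.
Lemma ecos_norm_le1 x : `|ecos x| <= 1. Proof. exact: cos_max. Qed.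
Lemma esin_norm_le1 x : `|esin x| <= 1. Proof. exact: sin_max. Qed.
Lemma ler_dist_ecos x y : `|ecos x - ecos y| <= 2 * pi * `|x - y|.
Proof.
apply: le_trans (ler_dist_cos _ _) _.
by rewrite -mulrBr normrM ger0_norm// mulr_ge0// pi_ge0.
Qed.

Lemma ler_dist_esin x y : `|esin x - esin y| <= 2 * pi * `|x - y|.
Proof.
apply: le_trans (ler_dist_sin _ _) _.
by rewrite -mulrBr normrM ger0_norm// mulr_ge0// pi_ge0.
Qed.

(** If the fractional part [f] were nonzero, [sin (pi * f)] would be positive, whereas the
    duplication formula forces [cos (pi * f) ^+ 2 = 1]. *)
Lemma ecos_eq1_int x : ecos x = 1 -> x \is a Num.int.
Proof.
move=> x1; pose f := x - (Num.floor x)%:~R.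
have fx : ecos f = 1 by rewrite -(ecos_addz f (Num.floor x)) subrK.
have /andP[f0 f1] : 0 <= f < 1.
  have := floor_itv x; rewrite intrD => /andP[h1 h2].
  by rewrite /f subr_ge0 h1 ltrBlDl.
have [f00|fn0] := eqVneq f 0.
  by rewrite -[x](subrK (Num.floor x)%:~R) -/f f00 add0r intr_int.
have f_gt0 : 0 < f by rewrite lt_neqAle eq_sym fn0.
have := @sin_gt0_pi R (pi * f).
rewrite mulr_gt0 ?pi_gt0//= gtr_pMr ?pi_gt0// f1 => /(_ isT).
move: fx; rewrite /ecos (_ : 2 * pi * f = (pi * f) *+ 2); last by rewrite -mulr_natl; ring.
rewrite cos_mulr2n => c1.
have := cos2Dsin2 (pi * f); nra.
Qed.

End UnitCircle.

Lemma cvg_sumr {R : realType} {T I : Type} (F : set_system T) {FF : Filter F}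
    (r : seq I) (f : I -> T -> R) (l : I -> R) :
  (forall i, f i x @[x --> F] --> l i) ->
  \sum_(i <- r) f i x @[x --> F] --> \sum_(i <- r) l i.
Proof.
move=> fl; elim: r => [|i r IH].
  by rewrite big_nil; under eq_fun do rewrite big_nil; exact: cvg_cst.
by rewrite big_cons; under eq_fun do rewrite big_cons; exact: cvgD.
Qed.

Lemma cvg_sum0 {R : realType} {T I : Type} (F : set_system T) {FF : Filter F}
    (r : seq I) (f : I -> T -> R) :
  (forall i, f i x @[x --> F] --> 0) -> \sum_(i <- r) f i x @[x --> F] --> 0.
Proof. by move=> /(@cvg_sumr _ _ _ _ _ r); rewrite big1. Qed.

(** * Vanishing exponential averages and van der Corput differencing *)

Section Equidistribution.
Context {R : realType} (w : nat -> R) (w_wt : weight w).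
Implicit Types (u v f g : nat -> R) (n h q : nat).

Definition mean_zero f :=
  avg w (fun n => ecos (f n)) N @[N --> \oo] --> 0 /\
  avg w (fun n => esin (f n)) N @[N --> \oo] --> 0.

Lemma mean_zero_near f g : f n - g n @[n --> \oo] --> 0 -> mean_zero g -> mean_zero f.
Proof.
move=> fg [gc gs]; have h (e : R -> R) (eL : forall x y, `|e x - e y| <= 2 * pi * `|x - y|) :
    e (f n) - e (g n) @[n --> \oo] --> 0.
  apply/cvgr0Pnorm_le => eps eps0.
  have p0 : 0 < 2 * pi :> R by rewrite mulr_gt0// pi_gt0.
  have /cvgr0Pnorm_le/(_ (eps / (2 * pi)) (divr_gt0 eps0 p0)) := fg.
  apply: filterS => n; rewrite ler_pdivlMr// mulrC => H.
  exact: le_trans (eL _ _) H.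
split.
- exact: cvg_avg_near (h _ (@ler_dist_ecos R)) gc.
- exact: cvg_avg_near (h _ (@ler_dist_esin R)) gs.
Qed.

Lemma mean_zero_addc f c : mean_zero f -> mean_zero (fun n => f n + c).
Proof.
move=> [fc fs]; split.
- rewrite (_ : (fun n => ecos (f n + c)) =
    (fun n => ecos c * ecos (f n) + (- esin c) * esin (f n))); last first.
    by apply/funext => n; rewrite ecosD; ring.
  under eq_fun do rewrite avgD !avgZ.
  by apply: cvgD0; exact: cvgZ0.
- rewrite (_ : (fun n => esin (f n + c)) =
    (fun n => esin c * ecos (f n) + ecos c * esin (f n))); last first.
    by apply/funext => n; rewrite esinD; ring.
  under eq_fun do rewrite avgD !avgZ.
  by apply: cvgD0; exact: cvgZ0.
Qed.

Lemma mean_zero_cvg f g (c : R) : f n - g n @[n --> \oo] --> c -> mean_zero g -> mean_zero f.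
Proof.
move=> fg gg; apply: (@mean_zero_near _ (fun n => g n + c)); last exact: mean_zero_addc.
under eq_fun do rewrite opprD addrA.
exact/subr_cvg0.
Qed.

(** Averaging [u] over [H] shifts hardly changes its average, and by [sqr_avg_le] the square of the
    result is at most about [1 / H]. The majorant [B] is left abstract so that the squared modulus
    of a complex sum can serve for both its real and its imaginary part. *)
Lemma van_der_corput_real u q (B : nat -> nat -> R) :
  (forall n, `|u n| <= 1) ->
  (forall H n, (\sum_(h < H) u (n + q * h)%N) ^+ 2 <= B H n) ->
  (forall H, avg w (B H) N @[N --> \oo] --> (H%:R : R)) ->
  avg w u N @[N --> \oo] --> 0.
Proof.
move=> u1 uB BH; apply/cvgr0Pnorm_le => e e0.
(* With this [H], the bound [2 / H] on the mean square is at most [(e / 2) ^+ 2]. *)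
pose H := (Num.trunc (8 / e ^+ 2)).+1.
have H_gt : 8 / e ^+ 2 < H%:R by rewrite /H truncnS_gt.
have H0 : 0 < H%:R :> R by rewrite ltr0n.
have e2 : 0 < e ^+ 2 by rewrite exprn_gt0.
have e8 : 8 < e ^+ 2 * H%:R by rewrite mulrC -ltr_pdivrMr.
pose U n := H%:R^-1 * \sum_(h < H) u (n + q * h)%N.
have dU : avg w u N - avg w U N @[N --> \oo] --> 0.
  rewrite (_ : (fun N => _) = fun N => - H%:R^-1 *
     \sum_(h < H) (avg w (fun n => u (n + q * h)%N) N - avg w u N)); last first.
    apply/funext => N; rewrite avgZ avg_sum sumrB sumr_const card_ord.
    by rewrite -[_ *+ H]mulr_natl; field; rewrite gt_eqF.
  apply: cvgZ0; apply: cvg_sum0 => h.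
  exact: (@cvg_avg_shift _ w w_wt u 1).
have e20 : 0 < e / 2 by rewrite divr_gt0.
have /cvgr0Pnorm_le/(_ _ e20) dU2 := dU.
near=> N.
have W0 : 0 < \sum_(n < N) w n by near: N; exact: near_weight_sum_gt0.
have BN : avg w (B H) N <= 2 * H%:R.
  near: N; apply: (cvgr_le _ (BH H)); rewrite mulr_natl mulr2n ltrDl//.
have UB : avg w (fun n => U n ^+ 2) N <= H%:R^-1 ^+ 2 * avg w (B H) N.
  rewrite -avgZ; apply: le_avg => // n.
  by rewrite /U exprMn ler_wpM2l ?sqr_ge0.
have Ue : `|avg w U N| <= e / 2.
  rewrite -(@ler_pXn2r _ 2) ?nnegrE ?normr_ge0 ?(ltW e20)//.
  rewrite -normrX ger0_norm ?sqr_ge0//.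
  apply: le_trans (sqr_avg_le w_wt _ W0) _; apply: le_trans UB _.
  apply: (@le_trans _ _ (H%:R^-1 ^+ 2 * (2 * H%:R))).
    by rewrite ler_wpM2l ?sqr_ge0.
  rewrite (_ : _ * _ = 2 * H%:R^-1); last by field; rewrite gt_eqF.
  by rewrite ler_pdivrMr// expr_div_n; lra.
rewrite -[avg w u N](subrK (avg w U N)) (le_trans (ler_normD _ _))//.
have : `|avg w u N - avg w U N| <= e / 2 by near: N.
lra.
Unshelve. all: by end_near. Qed.

(** Expanding the squared modulus of a sum of [H] shifts, the diagonal terms give [H] and the others
    average to 0. Only shifts by multiples of [q] occur, which is what keeps a period mod 1
    available later. *)
Lemma van_der_corput f q :
  (forall h, (0 < h)%N -> mean_zero (fun n => f (n + q * h)%N - f n)) -> mean_zero f.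
Proof.
move=> fh.
pose B H n : R := \sum_(h < H) \sum_(h' < H) ecos (f (n + q * h)%N - f (n + q * h')%N).
have BE H n : B H n = (\sum_(h < H) ecos (f (n + q * h)%N)) ^+ 2 +
                      (\sum_(h < H) esin (f (n + q * h)%N)) ^+ 2.
  rewrite !expr2 !mulr_suml -big_split; apply: eq_bigr => h _ /=.
  by rewrite !mulr_sumr -big_split; apply: eq_bigr => h' _ /=; rewrite ecosB.
(* Up to a shift by [q * h], which averages do not see, this is the hypothesis for [h' - h]. *)
have cross h h' : (h < h')%N ->
    avg w (fun n => ecos (f (n + q * h')%N - f (n + q * h)%N)) N @[N --> \oo] --> 0.
  move=> hh'; have h0 : (0 < h' - h)%N by rewrite subn_gt0.
  pose g n := ecos (f (n + q * (h' - h))%N - f n).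
  have [gc _] := fh _ h0.
  have := @cvg_avg_shift _ w w_wt g 1 (q * h) (fun n => ecos_norm_le1 _).
  move=> /cvgD0/(_ gc); under eq_fun do rewrite subrK.
  rewrite (_ : (fun n => g _) = (fun n => ecos (f (n + q * h')%N - f (n + q * h)%N)))//.
  apply/funext => n; rewrite /g; congr (ecos (f _ - _)).
  by rewrite -addnA -mulnDr subnKC// ltnW.
have Bcvg H : avg w (B H) N @[N --> \oo] --> (H%:R : R).
  have -> : avg w (B H) = fun N => \sum_(h < H) \sum_(h' < H)
     avg w (fun n => ecos (f (n + q * h)%N - f (n + q * h')%N)) N.
    by apply/funext => N; rewrite /B avg_sum; apply: eq_bigr => h _; rewrite avg_sum.
  have -> : H%:R = \sum_(h < H) \sum_(h' < H) (if h == h' then 1 else 0) :> R.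
    rewrite (eq_bigr (fun=> 1)); first by rewrite sumr_const card_ord.
    by move=> h _; rewrite -big_mkcond/= (big_pred1 h)// => h'; rewrite eq_sym.
  apply: cvg_sumr => h; apply: cvg_sumr => h'.
  have [->|] := eqVneq h h'.
    rewrite (_ : (fun n => ecos _) = fun=> 1); first exact: cvg_avg_cst.
    by apply/funext => n; rewrite subrr ecos0.
  rewrite neq_ltn => /orP[hh'|hh']; last exact: cross.
  under [X in avg w X]eq_fun do rewrite -ecosN opprB.
  exact: cross.
split.
- apply: (@van_der_corput_real _ q B) => // [n|H n]; first exact: ecos_norm_le1.
  by rewrite BE lerDl sqr_ge0.
- apply: (@van_der_corput_real _ q B) => // [n|H n]; first exact: esin_norm_le1.
  by rewrite BE lerDr sqr_ge0.
Qed.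

End Equidistribution.

(** * Two criteria: rotation by a nonintegral angle, and slow growth *)

Section EquidistributionCriteria.
Context {R : realType} (w : nat -> R) (w_wt : weight w).
Implicit Types (u v f g b Q : nat -> R) (n h q : nat).

(** Shifting by [q] does not change the limiting behaviour of the average of exp (2 i pi f), yet
    asymptotically multiplies it by exp (2 i pi beta), which is not 1. *)
Lemma mean_zero_rotation f q (k : nat -> int) (beta : R) : beta \isn't a Num.int ->
  f (n + q)%N - f n - (k n)%:~R @[n --> \oo] --> beta -> mean_zero w f.
Proof.
move=> beta_int fk.
have lim (e : R -> R) (eL : forall x y, `|e x - e y| <= 2 * pi * `|x - y|)
    (ez : forall x k, e (x + k%:~R) = e x) (e1 : forall x, `|e x| <= 1) :
    avg w (fun n => e (f n + beta)) N - avg w (fun n => e (f n)) N @[N --> \oo] --> 0.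
  under eq_fun do rewrite -avgB.
  apply: (@cvg_avg_near _ _ w_wt _ (fun n => e (f (n + q)%N) - e (f n))); last first.
    under eq_fun do rewrite avgB.
    exact: (@cvg_avg_shift _ w w_wt (fun n => e (f n)) 1).
  apply/cvgr0Pnorm_le => eps eps0.
  have p0 : 0 < 2 * pi :> R by rewrite mulr_gt0// pi_gt0.
  have /subr_cvg0/cvgr0Pnorm_le/(_ (eps / (2 * pi)) (divr_gt0 eps0 p0)) := fk.
  apply: filterS => n; rewrite ler_pdivlMr// mulrC => H.
  rewrite (_ : e _ - _ - _ = e (f n + beta) - e (f (n + q)%N)); last by ring.
  rewrite -(ez _ (k n)) distrC (le_trans (eL _ _))// (le_trans _ H)//.
  have -> : f (n + q)%N - (f n + beta + (k n)%:~R) = f (n + q)%N - f n - (k n)%:~R - beta.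
    by ring.
  by [].
(* In real coordinates [1 - exp (2 i pi beta)] is [c - i s]; the two limits below say that its
   product with [C + i S] tends to 0, and [c ^+ 2 + s ^+ 2] is the determinant of the system. *)
pose c := 1 - ecos beta; pose s : R := esin beta.
pose C := avg w (fun n => ecos (f n)); pose S := avg w (fun n => esin (f n)).
have X0 : c * C N + s * S N @[N --> \oo] --> 0.
  have := lim _ (@ler_dist_ecos R) (@ecos_addz R) (@ecos_norm_le1 R).
  rewrite (_ : (fun n => ecos (f n + beta)) =
    (fun n => ecos beta * ecos (f n) + (- esin beta) * esin (f n))); last first.
    by apply/funext => n; rewrite ecosD; ring.
  under eq_fun do rewrite avgD !avgZ.
  move=> /(@cvgZ0 _ _ _ _ (-1)); apply: cvg_trans; apply: near_eq_cvg.
  by apply: nearW => N; rewrite /C /S /c /s; ring.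
have Y0 : c * S N - s * C N @[N --> \oo] --> 0.
  have := lim _ (@ler_dist_esin R) (@esin_addz R) (@esin_norm_le1 R).
  rewrite (_ : (fun n => esin (f n + beta)) =
    (fun n => esin beta * ecos (f n) + ecos beta * esin (f n))); last first.
    by apply/funext => n; rewrite esinD; ring.
  under eq_fun do rewrite avgD !avgZ.
  move=> /(@cvgZ0 _ _ _ _ (-1)); apply: cvg_trans; apply: near_eq_cvg.
  by apply: nearW => N; rewrite /C /S /c /s; ring.
have D0 : c ^+ 2 + s ^+ 2 != 0.
  rewrite paddr_eq0 ?sqr_ge0// !expf_eq0/= subr_eq0 negb_and.
  by apply/orP; left; apply: contra beta_int => /eqP h; apply: ecos_eq1_int.
split.
- rewrite [X in X @ _ --> _](_ : _ = fun N => (c ^+ 2 + s ^+ 2)^-1 *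
    (c * (c * C N + s * S N) + (- s) * (c * S N - s * C N))); last first.
    by apply/funext => N; rewrite -/(C N); field.
  by apply: cvgZ0; apply: cvgD0; exact: cvgZ0.
- rewrite [X in X @ _ --> _](_ : _ = fun N => (c ^+ 2 + s ^+ 2)^-1 *
    (s * (c * C N + s * S N) + c * (c * S N - s * C N))); last first.
    by apply/funext => N; rewrite -/(S N); field.
  by apply: cvgZ0; apply: cvgD0; exact: cvgZ0.
Qed.

Lemma telescope_bound u (C : R) q N : (forall n, `|u n| <= C) ->
  `|\sum_(n < N) (u (n + q)%N - u n)| <= 2 * C * q%:R.
Proof.
move=> uC; elim: q => [|q IH].
  by rewrite mulr0 big1 ?normr0// => i _; rewrite addn0 subrr.
rewrite (_ : \sum_(n < N) _ = (u (N + q)%N - u q) + \sum_(n < N) (u (n + q)%N - u n)).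
  rewrite (le_trans (ler_normD _ _))// -[q.+1%:R]natr1 mulrDr mulr1 [leRHS]addrC lerD//.
  by rewrite (le_trans (ler_normB _ _))//; have := uC (N + q)%N; have := uC q; lra.
elim: N {IH} => [|N IH]; first by rewrite !big_ord0 add0n; ring.
by rewrite !big_ord_recr/= IH addnS addSn; ring.
Qed.

Context (w0 : w n @[n --> \oo] --> 0).

(* With [g := Q + xi * b] the increments [ecos (g (n + q)) - ecos (g n)]
   telescope, and to first order they are
   [- 2 * pi * xi * q * w n * esin (g n)]. *)
Lemma mean_zero_slow Q b f q (xi c : R) : (0 < q)%N ->
  (forall n, b n.+1 - b n = w n) ->
  (forall n, Q (n + q)%N - Q n \is a Num.int) -> xi != 0 ->
  f n - xi * b n @[n --> \oo] --> c -> mean_zero w (fun n => Q n + f n).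
Proof.
move=> q0 bw + xi0 fb.
have w_ge0 := weight_ge0 w_wt.
suff sin0 (P : nat -> R) : (forall n, P (n + q)%N - P n \is a Num.int) ->
    avg w (fun n => esin (P n + xi * b n)) N @[N --> \oo] --> 0.
  move=> QZ; apply: (@mean_zero_cvg _ w w_wt _ (fun n => Q n + xi * b n) c).
    by under eq_fun do rewrite opprD addrACA subrr add0r.
  split; last exact: sin0.
  (* A quarter turn changes cosine into sine and can be absorbed in the periodic part. *)
  rewrite (_ : (fun n => ecos _) = (fun n => esin ((Q n + 1 / 4) + xi * b n))).
    by apply: (sin0 (fun n => Q n + 1 / 4)) => n; rewrite opprD addrACA subrr addr0 QZ.
  apply/funext => n; rewrite /ecos /esin -sinDpihalf; congr sin.
  by field.
move=> PZ; pose g n := P n + xi * b n.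
pose K := 2 * pi * xi * q%:R.
have K0 : K != 0 by rewrite !mulf_neq0// ?gt_eqF ?pi_gt0// ltr0n.
have bq n h : b (n + h)%N - b n = \sum_(i < h) w (n + i)%N.
  elim: h => [|h IH]; first by rewrite addn0 subrr big_ord0.
  by rewrite big_ord_recr/= -IH addnS -bw; ring.
pose D n := 2 * pi * (xi * (b (n + q)%N - b n)).
have piK : `|2 * pi * xi| * q%:R = `|K| by rewrite [RHS]normrM normr_nat.
have DK n : `|D n| <= `|K| * w n.
  rewrite /D mulrA normrM -piK -[leRHS]mulrA ler_wpM2l//.
  rewrite bq ger0_norm ?sumr_ge0//.
  rewrite [leRHS](_ : _ = \sum_(i < q) w n); last by rewrite sumr_const card_ord mulr_natl.
  by apply: ler_sum => i _; apply: (weight_noninc_le w_wt); exact: leq_addr.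
(* Replacing [D n] by [K * w n] costs an error that telescopes when summed over [n]. *)
have KD n : `|K * w n - D n| <= `|K| * (w n - w (n + q)%N).
  have -> : K * w n - D n = 2 * pi * xi * \sum_(i < q) (w n - w (n + i)%N).
    rewrite /D bq sumrB sumr_const card_ord -[w n *+ q]mulr_natl /K; ring.
  rewrite normrM -piK -[leRHS]mulrA ler_wpM2l//.
  rewrite ger0_norm; last first.
    by apply: sumr_ge0 => i _; rewrite subr_ge0; apply: (weight_noninc_le w_wt); exact: leq_addr.
  rewrite [leRHS](_ : _ = \sum_(i < q) (w n - w (n + q)%N)); last by rewrite sumr_const card_ord mulr_natl.
  apply: ler_sum => i _; rewrite lerB//; apply: (weight_noninc_le w_wt).
  by rewrite leq_add2l ltnW.
pose E n := ecos (g (n + q)%N) - ecos (g n) + D n * esin (g n).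
have ED n : `|E n| <= D n ^+ 2.
  have /intrP[k kE] := PZ n.
  have gq : g (n + q)%N = (g n + xi * (b (n + q)%N - b n)) + k%:~R.
    by rewrite -kE /g; ring.
  rewrite /E gq ecos_addz /ecos mulrDr -/(D n); exact: cos_taylor1.
(* If [w n = 0] then [D n] and hence [E n] vanish, so [w n * e n = E n] holds with the default
   quotient 0 too. *)
pose e n := E n / w n.
have Ee n : w n * e n = E n.
  have [wn0|wn0] := eqVneq (w n) 0; last by rewrite /e mulrC divfK.
  rewrite wn0 mul0r; apply/esym/eqP; rewrite -normr_le0.
  have D0 : D n = 0 by apply/eqP; rewrite -normr_le0 (le_trans (DK _))// wn0 mulr0.
  by rewrite (le_trans (ED _))// D0 expr0n.
have e0 : e n @[n --> \oo] --> 0.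
  have eK n : `|e n| <= K ^+ 2 * w n.
    have [wn0|wn0] := eqVneq (w n) 0; first by rewrite /e wn0 invr0 mulr0 normr0 mulr0.
    have wn_gt0 : 0 < w n by rewrite lt_neqAle eq_sym wn0 w_ge0.
    rewrite /e normrM normfV (gtr0_norm wn_gt0) ler_pdivrMr//.
    rewrite (le_trans (ED _))// -mulrA -expr2 -exprMn -[leLHS]real_normK ?num_real//.
    rewrite -[leRHS]real_normK ?num_real// ler_pXn2r ?nnegrE//.
    by rewrite (le_trans (DK _))// [leRHS]normrM (gtr0_norm wn_gt0).
  apply/cvgr0Pnorm_le => eps eps0.
  have K2 : 0 < K ^+ 2 by rewrite exprn_even_gt0.
  have /cvgr0Pnorm_le/(_ (eps / K ^+ 2) (divr_gt0 eps0 K2)) := w0.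
  apply: filterS => n; rewrite ler_pdivlMr// mulrC ger0_norm// => H.
  exact: le_trans (eK _) H.
rewrite (_ : (fun n => esin _) = (fun n => K^-1 * (e n + (K * esin (g n) - e n)))); last first.
  by apply/funext => n; rewrite -/(g n); field.
under eq_fun do rewrite avgZ avgD.
apply: cvgZ0; apply: cvgD0; first exact: cvg_avg0.
(* The first term bounds the error made on [D n], the second the telescoping sum of the increments
   of [ecos (g n)]. *)
apply: (@cvg_avg_bounded_sum _ w w_wt _ (`|K| * (2 * w 0%N * q%:R) + 2 * 1 * q%:R)) => N.
rewrite (_ : \sum_(n < N) _ = \sum_(n < N) (K * w n - D n) * esin (g n)
   - \sum_(n < N) (ecos (g (n + q)%N) - ecos (g n))); last first.
  rewrite -sumrB; apply: eq_bigr => n _; rewrite mulrBr Ee /E; ring.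
rewrite (le_trans (ler_normB _ _))// lerD//; last first.
  by apply: (@telescope_bound (fun n => ecos (g n))) => n; exact: ecos_norm_le1.
rewrite (le_trans (ler_norm_sum _ _ _))//.
apply: (@le_trans _ _ (\sum_(n < N) `|K| * (w n - w (n + q)%N))).
  apply: ler_sum => n _; rewrite normrM -[leRHS]mulr1 ler_pM//.
  exact: esin_norm_le1.
rewrite -mulr_sumr ler_wpM2l//.
rewrite (le_trans (ler_norm _))// -normrN -sumrN.
under eq_bigr do rewrite opprB.
apply: telescope_bound => n.
by rewrite ger0_norm//; exact: (weight_noninc_le w_wt).
Qed.

End EquidistributionCriteria.

(** * Polynomial phases: rational against irrational coefficients *)

Section PolynomialPhases.
Context {R : realType}.
Implicit Types (P Q : {poly R}) (f g b : nat -> R) (n h q s : nat).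

(** The constant term is left free, as it only adds a constant to the phase; [m] is a common
    denominator of the other coefficients. *)
Definition rational_nonconstant Q :=
  exists2 m : nat, (0 < m)%N & forall i, (0 < i)%N -> m%:R * Q`_i \is a Num.int.

Definition periodic_mod1 q f := forall n, f (n + q)%N - f n \is a Num.int.

Lemma periodic_mod1_mul q f k : periodic_mod1 q f -> periodic_mod1 (q * k) f.
Proof.
move=> fq n; elim: k => [|k IH]; first by rewrite muln0 addn0 subrr.
rewrite mulnS addnCA -(subrK (f (n + q * k)%N) (f _)) -addrA rpredD//.
by rewrite addnC; exact: fq.
Qed.

Lemma periodic_mod1D q1 q2 f g : periodic_mod1 q1 f -> periodic_mod1 q2 g ->
  periodic_mod1 (q1 * q2) (fun n => f n + g n).
Proof.
move=> fq gq n; rewrite opprD addrACA rpredD//; first exact: periodic_mod1_mul.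
by rewrite mulnC; exact: periodic_mod1_mul.
Qed.

Lemma periodic_mod1_monomial (c : R) m s : m%:R * c \is a Num.int ->
  periodic_mod1 m (fun n => c * n%:R ^+ s).
Proof.
move=> mc n; have le : (n ^ s <= (n + m) ^ s)%N.
  by case: s => // s; rewrite leq_exp2r// leq_addr.
have /dvdnP[t tE] : (m %| (n + m) ^ s - n ^ s)%N.
  by rewrite -eqn_mod_dvd// -modnXm modnDr modnXm.
rewrite -mulrBr -!natrX -natrB// tE natrM mulrCA [c * _]mulrC.
by rewrite rpredM// natr_int.
Qed.

Lemma periodic_mod1_rational Q : rational_nonconstant Q ->
  exists2 m, (0 < m)%N & periodic_mod1 m (fun n => Q.[n%:R]).
Proof.
move=> [m m0 mQ]; exists m => // n.
rewrite !horner_coef -sumrB rpred_sum// => -[[|i] isQ] _ /=.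
  by rewrite !expr0 subrr.
exact: (@periodic_mod1_monomial _ m i.+1 (mQ i.+1 isT) n).
Qed.

(** The witness is the Taylor expansion of [Q] at [x] without its constant term; only the first
    derivative contributes to the coefficient of degree [s]. *)
Lemma poly_difference Q s (a : R) : (size Q <= s.+2)%N ->
  exists Q2 : {poly R}, [/\ (size Q2 <= s.+1)%N,
    forall x, Q2.[x] = Q.[x + a] - Q.[x] &
    Q2`_s = s.+1%:R * a * Q`_s.+1].
Proof.
move=> sQ; exists (\sum_(i < s.+1) a ^+ i.+1 *: Q^`N(i.+1)).
have coefE j : (\sum_(i < s.+1) a ^+ i.+1 *: Q^`N(i.+1))`_j =
    \sum_(i < s.+1) a ^+ i.+1 * (Q`_(i.+1 + j) *+ 'C(i.+1 + j, i.+1)).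
  by rewrite coef_sum; apply: eq_bigr => i _; rewrite coefZ coef_nderivn.
split.
- apply/leq_sizeP => j sj; rewrite coefE big1// => i _.
  by rewrite nth_default ?mul0rn ?mulr0// (leq_trans sQ)// addSn ltnS (leq_trans sj)// leq_addl.
- move=> x; rewrite (nderiv_taylor_wide _ sQ); last exact: mulrC.
  rewrite [X in _ = X - _]big_ord_recl/= nderivn0 expr0 mulr1 [X in X - _]addrC addrK horner_sum.
  by apply: eq_bigr => i _; rewrite hornerZ mulrC.
- rewrite coefE big_ord_recl/= big1 ?addr0; last first.
    move=> i _; rewrite nth_default ?mul0rn ?mulr0//.
    by rewrite (leq_trans sQ)// /bump/= !add1n !addSn !ltnS leq_addl.
  by rewrite expr1 add1n bin1 -mulr_natl; ring.
Qed.

Lemma cvg_shift_difference f h : f n.+1 - f n @[n --> \oo] --> 0 ->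
  f (n + h)%N - f n @[n --> \oo] --> 0.
Proof.
move=> f0; elim: h => [|h IH].
  by under eq_fun do rewrite addn0 subrr; exact: cvg_cst.
rewrite (_ : (fun n => _) = fun n =>
  (f (n + h).+1 - f (n + h)%N) + (f (n + h)%N - f n)); last first.
  by apply/funext => n; rewrite addnS; ring.
apply: cvgD0 => //.
by move: f0; rewrite -(cvg_shiftn h).
Qed.

Section Dichotomy.
Context (w : nat -> R) (w_wt : weight w).

(* By induction on the size of [Q]: a rational leading coefficient makes the
   leading term periodic mod [1], so it can be moved into [Z]; an irrational one
   is handled by [mean_zero_rotation] in degree [1], and by differencing with
   multiples of the period [q], which preserve irrationality, in higher degree. *)
Lemma poly_dichotomy s Q (Z f : nat -> R) q : (size Q <= s)%N -> (0 < q)%N ->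
  periodic_mod1 q Z -> f n.+1 - f n @[n --> \oo] --> 0 ->
  rational_nonconstant Q \/ mean_zero w (fun n => Q.[n%:R] + Z n + f n).
Proof.
elim: s Q Z f q => [|s IH] Q Z f q sQ q0 Zq f0.
  left; exists 1%N => // i _; rewrite nth_default ?mulr0 ?rpred0// (leq_trans sQ)//.
have [s0|s0] := posnP s.
  left; exists 1%N => // i i0; rewrite nth_default ?mulr0 ?rpred0//.
  by rewrite (leq_trans sQ)// s0.
pose c := Q`_s.
have [[m m0 mc]|irr] := pselect (exists2 m, (0 < m)%N & m%:R * c \is a Num.int).
  pose Q' := Q - c *: 'X^s.
  have Q'E i : Q'`_i = if i == s then 0 else Q`_i.
    rewrite coefB coefZ coefXn; case: eqP => [->|_]; first by rewrite mulr1 subrr.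
    by rewrite mulr0 subr0.
  have sQ' : (size Q' <= s)%N.
    apply/leq_sizeP => j; rewrite leq_eqVlt Q'E eq_sym => /orP[->//|sj].
    by rewrite gt_eqF// nth_default// (leq_trans sQ).
  have Z'q := periodic_mod1D Zq (periodic_mod1_monomial s mc).
  have [|[m' m'0 rQ']|gQ'] := IH Q' _ f (q * m)%N sQ' _ Z'q f0.
  - by rewrite muln_gt0 q0.
  - left; exists (m * m')%N; first by rewrite muln_gt0 m0.
    move=> i i0; have [->|ins] := eqVneq i s.
      by rewrite mulnC natrM -mulrA rpredM// natr_int.
    have := rQ' _ i0; rewrite Q'E (negbTE ins) => h.
    by rewrite natrM -mulrA rpredM// natr_int.
  - right; rewrite (_ : (fun n => _) = fun n => Q'.[n%:R] + (Z n + c * n%:R ^+ s) + f n)//.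
    by apply/funext => n; rewrite hornerD hornerN hornerZ hornerXn; ring.
have irrM m : (0 < m)%N -> m%:R * c \isn't a Num.int.
  by move=> m0; apply/negP => mc; apply: irr; exists m.
have fq h := cvg_shift_difference h f0.
right; case: s s0 sQ @c irr irrM IH => // -[|s] _ sQ c irr irrM IH.
  have /choice[k kE] n : exists k : int, Z (n + q)%N - Z n = k%:~R.
    by have /intrP := Zq n.
  apply: (@mean_zero_rotation _ w w_wt _ q k (q%:R * c)); first exact: irrM.
  have QE x : Q.[x] = Q`_0 + c * x.
    by rewrite (horner_coef_wide _ sQ) !big_ord_recl big_ord0/= expr0 expr1 addr0 mulr1.
  rewrite (_ : (fun n => _) = fun n => (f (n + q)%N - f n) + q%:R * c); last first.
    by apply/funext => n; rewrite -kE !QE natrD; ring.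
  by apply/subr_cvg0; under eq_fun do rewrite addrK; exact: fq.
apply: (@van_der_corput _ w w_wt _ q) => h h0.
have [Q2 [sQ2 Q2E cQ2]] := poly_difference (q * h)%:R sQ.
pose f2 n := f (n + q * h)%N - f n; pose Z2 n := Z (n + q * h)%N - Z n.
have f20 : f2 n.+1 - f2 n @[n --> \oo] --> 0.
  under eq_fun do rewrite -[- f2 _]mulN1r.
  apply: cvgD0; last by apply: cvgZ0; exact: fq.
  by have := fq (q * h)%N; rewrite -cvg_shiftS.
(* [Z2] takes integer values, so it has period 1 mod 1. *)
have Z2q : periodic_mod1 1 Z2.
  by move=> n; rewrite rpredB//; exact: periodic_mod1_mul.
have [|[m m0 rQ2]|] := IH Q2 Z2 f2 1%N sQ2 _ Z2q f20.
- by [].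
(* The coefficient of degree [s.+1] in [Q2] is a positive integer multiple of [c], so it is
   irrational as well. *)
- have := rQ2 s.+1 isT; rewrite cQ2 mulrA mulrA -!natrM => mc.
  have := irrM (m * (s.+2 * (q * h)))%N.
  by rewrite !muln_gt0 m0 q0 h0 => /(_ isT); rewrite mulnA mc.
- rewrite (_ : (fun n => Q.[_] + _ + _ - _) = fun n => Q2.[n%:R] + Z2 n + f2 n)//.
  by apply/funext => n; rewrite Q2E /Z2 /f2 natrD; ring.
Qed.

End Dichotomy.
End PolynomialPhases.

(** * Iterated differences and the splitting into a polynomial and a slow part *)

Section FiniteDifferences.
Context {R : realType}.
Implicit Types (P Q : {poly R}) (f g b w s : nat -> R) (c : R) (n h q j d : nat).

Definition fdiff f n := f n.+1 - f n.

Lemma iter_fdiffB j f g n :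
  iter j fdiff (fun n => f n - g n) n = iter j fdiff f n - iter j fdiff g n.
Proof. by elim: j n => //= j IH n; rewrite /fdiff !IH; ring. Qed.

Lemma iter_fdiffZ j c f n : iter j fdiff (fun n => c * f n) n = c * iter j fdiff f n.
Proof. by elim: j n => //= j IH n; rewrite /fdiff !IH; ring. Qed.

Lemma iter_fdiff_shift j f h n :
  iter j fdiff (fun n => f (n + h)%N) n = iter j fdiff f (n + h)%N.
Proof. by elim: j n => //= j IH n; rewrite /fdiff !IH. Qed.

Lemma sum_fdiff f n h : \sum_(i < h) fdiff f (n + i)%N = f (n + h)%N - f n.
Proof.
elim: h => [|h IH]; first by rewrite big_ord0 addn0 subrr.
by rewrite big_ord_recr/= IH /fdiff addnS; ring.
Qed.

(** The recursion is (d + 1) C(n, d + 1) = (n - d) C(n, d), both sides being 0 for n < d. *)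
Lemma binomial_poly d : exists P, forall n, P.[n%:R] = 'C(n, d)%:R.
Proof.
elim: d => [|d [P PE]]; first by exists 1 => n; rewrite hornerC bin0.
exists (d.+1%:R^-1 *: (('X - d%:R%:P) * P)) => n.
rewrite hornerZ hornerM hornerXsubC PE.
have d0 : d.+1%:R != 0 :> R by rewrite pnatr_eq0.
apply: (mulfI d0).
rewrite mulrA divff ?pnatr_eq0// mul1r -natrM mul_bin_left.
by have [dn|nd] := leqP d n; [rewrite natrM natrB|rewrite bin_small// muln0 mulr0].
Qed.

Lemma iter_fdiff_bin d n : iter d fdiff (fun n => 'C(n, d)%:R) n = 1.
Proof.
elim: d n => [|d IH] n; first by rewrite /= bin0.
rewrite iterSr -[RHS](IH n); congr (iter d fdiff _ n); apply/funext => m.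
by rewrite /fdiff binS natrD addrAC subrr add0r.
Qed.

(** Since the sum of [w] diverges, [b] tends to infinity, with increments decreasing to 0. *)
Definition slow b w :=
  [/\ weight w, w n @[n --> \oo] --> 0 & forall n, b n.+1 - b n = w n].

(** For [j = 0], [poly_dichotomy] either concludes or makes [Q] periodic mod 1, and then
    [mean_zero_slow] applies. Otherwise differencing by [h] lowers [j]: the new difference is a sum
    of [h] values of the old one, each close to [xi * b n + c]. The polynomial changes on the way,
    whence the arbitrary [Q]. *)
Lemma mean_zero_slow_iter_fdiff w b j Q f (xi c : R) : slow b w -> xi != 0 ->
  iter j fdiff f n - xi * b n @[n --> \oo] --> c ->
  mean_zero w (fun n => Q.[n%:R] + f n).
Proof.
move=> [w_wt w0 bw] xi0; elim: j Q f xi c xi0 => [|j IH] Q f xi c xi0 fb.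
  have f0 : f n.+1 - f n @[n --> \oo] --> 0.
    rewrite (_ : (fun n => _) = fun n => xi * w n +
      ((f n.+1 - xi * b n.+1) + (-1) * (f n - xi * b n))); last first.
      by apply/funext => n; rewrite -bw; ring.
    apply: cvgD0; first exact: cvgZ0.
    rewrite -(subrr c) -[- c]mulN1r; apply: cvgD; last exact: cvgMr.
    by move: fb; rewrite -cvg_shiftS.
  have Z0 : periodic_mod1 1 (fun=> 0 : R) by move=> n; rewrite subrr rpred0.
  have [||] := poly_dichotomy w_wt (leqnn (size Q)) _ Z0 f0.
  - by [].
  - move=> /periodic_mod1_rational[m m0 mQ].
    exact: (mean_zero_slow w_wt w0 m0 bw mQ xi0 fb).
  - by rewrite (_ : (fun n => Q.[_] + 0 + f n) = fun n => Q.[n%:R] + f n)//;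
      apply/funext => n; rewrite addr0.
apply: (@van_der_corput _ w w_wt _ 1) => h h0.
have [Q2 [_ Q2E _]] := @poly_difference R Q (size Q) h%:R (leq_trans (leqnSn _) (leqnSn _)).
rewrite (_ : (fun n => _ - _) = fun n => Q2.[n%:R] + (f (n + h)%N - f n)); last first.
  by apply/funext => n; rewrite mul1n Q2E natrD; ring.
apply: (IH _ _ (h%:R * xi) (\sum_(i < h) c)); first by rewrite mulf_neq0// pnatr_eq0 -lt0n.
rewrite (_ : (fun n => _ - _) = fun n => \sum_(i < h)
   ((iter j.+1 fdiff f (n + i)%N - xi * b (n + i)%N) + xi * (b (n + i)%N - b n))); last first.
  apply/funext => n; rewrite iter_fdiffB iter_fdiff_shift -sum_fdiff.
  rewrite (_ : h%:R * xi * b n = \sum_(i < h) xi * b n); last first.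
    by rewrite sumr_const card_ord -[RHS]mulr_natl; ring.
  by rewrite -sumrB; apply: eq_bigr => i _; rewrite iterS; ring.
apply: cvg_sumr => i; rewrite -[c in X in _ --> X]addr0; apply: cvgD.
  by move: fb; rewrite -(cvg_shiftn i).
apply: cvgZ0; apply: cvg_shift_difference.
by under eq_fun do rewrite bw.
Qed.

Lemma nondecreasing_cvg_or_dvg f : (forall n, f n <= f n.+1) ->
  (exists l : R, f n @[n --> \oo] --> l) \/ f n @[n --> \oo] --> +oo.
Proof.
move=> /nondecreasing_seqP fnd.
have [cf|ncf] := pselect (cvgn f); first by left; exists (limn f).
by right; apply: nondecreasing_dvgn_lt.
Qed.

(* Subtracting a polynomial lowers the order of the last difference that does
   not tend to [0], until that difference is unbounded. *)
Lemma slow_decomposition d s (sg : R) : sg ^+ 2 = 1 ->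
  iter d fdiff s n @[n --> \oo] --> 0 ->
  (forall n, 0 <= sg * iter d.+1 fdiff s n) ->
  exists P e, (forall n, s n = P.[n%:R] + e n) /\
    (e n @[n --> \oo] --> 0 \/
     exists j tau b w, [/\ slow b w, tau != 0 &
       forall n, iter j fdiff e n = tau * b n]).
Proof.
elim: d s sg => [|d IH] s sg sg2 s0 s_mono.
  by exists 0, s; split; [move=> n; rewrite horner0 add0r|left].
have sg0 : sg != 0 by apply: contraPneq sg2 => ->; rewrite expr0n => /eqP; rewrite eq_sym oner_eq0.
pose t := iter d.+1 fdiff s; pose w n := - sg * t n.
pose b n := - sg * iter d fdiff s n.
have bw n : b n.+1 - b n = w n by rewrite /b /w /t /= /fdiff; ring.
have w_noninc n : w n.+1 <= w n.
  have := s_mono n; rewrite iterS /fdiff -/t /w; lra.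
have w0 : w n @[n --> \oo] --> 0 by exact: cvgZ0.
have w_ge0 n : 0 <= w n.
  have w_dec : {homo w : n m / (n <= m)%N >-> m <= n} by apply/nonincreasing_seqP.
  have wl : limn w = 0 by apply/cvg_lim.
  by rewrite -wl; apply: nonincreasing_cvgn_ge => //; apply/cvg_ex; exists 0.
have [[l bl]|b_oo] : (exists l : R, b n @[n --> \oo] --> l) \/ b n @[n --> \oo] --> +oo.
- by apply: nondecreasing_cvg_or_dvg => n; rewrite -subr_ge0 bw.
(* If [b] converges, the [d]-th difference of [s] tends to [c]. Subtracting [c] times the binomial
   polynomial, whose [d]-th difference is 1, makes it tend to 0; the next difference is unchanged
   and has the sign required with [- sg] for [sg]. *)
- pose c := - sg * l.
  have sgsg x : - sg * (- sg * x) = x by rewrite mulrA mulrNN -expr2 sg2 mul1r.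
  have [B BE] := binomial_poly d.
  have s'E n : iter d fdiff (fun n => s n - c * B.[n%:R]) n = iter d fdiff s n - c.
    rewrite iter_fdiffB iter_fdiffZ (_ : (fun n => B.[_]) = (fun n => 'C(n, d)%:R)); last exact/funext.
    by rewrite iter_fdiff_bin mulr1.
  have s'0 : iter d fdiff (fun n => s n - c * B.[n%:R]) n @[n --> \oo] --> 0.
    under eq_fun do rewrite s'E -[X in X - _]sgsg -mulrBr.
    by apply: cvgZ0; apply/subr_cvg0.
  have s'_mono n : 0 <= - sg * iter d.+1 fdiff (fun n => s n - c * B.[n%:R]) n.
    have := w_ge0 n; rewrite -bw /b; set F := (fun n => _ - _).
    rewrite (_ : iter d.+1 fdiff F n = iter d fdiff F n.+1 - iter d fdiff F n)// !s'E; lra.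
  have sgN2 : (- sg) ^+ 2 = 1 by rewrite sqrrN.
  have [P [e [sE eE]]] := IH _ _ sgN2 s'0 s'_mono.
  exists (P + c *: B), e; split=> // n.
  by rewrite hornerD hornerZ -[s n](subrK (c * B.[n%:R])) sE; ring.
- exists 0, s; split=> [n|]; first by rewrite horner0 add0r.
  right; exists d, (- sg), b, w; split; last 2 first.
  + by rewrite oppr_eq0.
  + by move=> n; rewrite /b mulrA mulrNN -expr2 sg2 mul1r.
  split => //; split => //.
  have -> : (fun N => \sum_(n < N) w n) = fun N => b N - b 0%N.
    apply/funext => N; elim: N => [|N IHN]; first by rewrite big_ord0 subrr.
    by rewrite big_ord_recr/= IHN -bw; ring.
  apply/cvgryPge => A; move/cvgryPge : b_oo => /(_ (A + b 0%N)).
  by apply: filterS => n; rewrite lerBrDr.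
Qed.

End FiniteDifferences.

(** * Hardy fields: eventual signs and derivatives tending to 0 *)

Section HardyFields.
Context {R : realType}.
Implicit Types (f g a : R -> R) (F : nat -> R -> R) (x y h X : R) (d i : nat).

Lemma pinftyP (P : set R) : (\forall x \near +oo, P x) <-> exists X, forall x, X < x -> P x.
Proof.
split=> [[X [_ XP]]|[X XP]]; first by exists X.
by exists X; split; [exact: num_real|].
Qed.

(** A nonzero germ is invertible, so [f] has no zero beyond some point; being continuous there, it
    keeps its sign. *)
Lemma hardy_sign (H : set (R -> R)) f : is_hardy_field H -> H f ->
  exists2 sg : R, sg ^+ 2 = 1 & \forall x \near +oo, 0 <= sg * f x.
Proof.
move=> hH Hf; have [f0|/(hardy_inv hH Hf)[g _ fg]] := pselect (germ_eq f (fun=> 0)).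
  exists 1; rewrite ?expr1n//; apply: filterS f0 => x ->.
  by rewrite mulr0.
have [df _] := hardy_derive hH Hf.
have [X XP] := (pinftyP _).1 (filterI fg df).
have fn0 x : X < x -> f x != 0.
  by move=> /XP[+ _]; apply: contra_eq_neq => /= ->; rewrite mul0r eq_sym oner_eq0.
pose x0 := X + 1; have Xx0 : X < x0 by rewrite ltrDl.
exists (Num.sg (f x0)); first by rewrite sqr_sg fn0.
apply/pinftyP; exists x0 => x x0x; rewrite leNgt; apply/negP => neg.
have fc : {within `[x0, x], continuous f}.
  apply: derivable_within_continuous => y; rewrite in_itv/= => /andP[x0y _].
  by have [] := XP y (lt_le_trans Xx0 x0y).
have [|y] := @IVT R f x0 x 0 (ltW x0x) fc.
  have := fn0 _ Xx0; move: neg; rewrite ge_min le_max.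
  case: (sgrP (f x0)) => [//|f0 + _|f0 + _].
  - by rewrite mul1r => /ltW ->.
  - by rewrite mulN1r oppr_lt0 => /ltW ->.
rewrite in_itv/= => /andP[x0y _] fy0.
by have := fn0 y (lt_le_trans Xx0 x0y); rewrite fy0 eqxx.
Qed.

Lemma hardy_derive1n (H : set (R -> R)) f i : is_hardy_field H -> H f ->
  H (derive1n i f).
Proof.
move=> hH Hf; elim: i => [//|i IH].
by rewrite derive1nS; exact: (hardy_derive hH IH).2.
Qed.

Lemma is_derive_shift f (df y h : R) :
  is_derive (y + h) 1 f df -> is_derive y 1 (fun z => f (z + h)) df.
Proof.
move=> fd; rewrite -[df]mulr1; apply: (@is_derive1_comp R f (fun z => z + h)) => //.
by rewrite -[1 in X in is_derive _ _ _ X]addr0; exact: (@is_deriveD _ _ _ id (cst h)).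
Qed.

(** [F] is a family of successive derivatives, so that the induction hypothesis applies to the
    family [G] of its differences; one more mean value step then gives [F d]. *)
Lemma MVT_iter_difference F d X h : 0 < h ->
  (forall i y, (i < d)%N -> X < y -> is_derive y 1 (F i) (F i.+1 y)) ->
  forall x, X < x -> exists2 z, x <= z <= x + d%:R * h &
    iter d (fun g y => g (y + h) - g y) (F 0%N) x = h ^+ d * F d z.
Proof.
move=> h0; elim: d F => [|d IH] F Fd x Xx.
  by exists x; rewrite ?mul0r ?addr0 ?lexx// mul1r.
pose G i y := F i (y + h) - F i y.
have [|z /andP[xz zx] E] := IH G _ x Xx.
  move=> i y id Xy; apply: is_deriveB; last by apply: Fd => //; exact: ltnW.
  apply: is_derive_shift; apply: Fd; first exact: ltnW.
  by rewrite (lt_trans Xy)// ltrDl.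
have Xz := lt_le_trans Xx xz.
have Fdd y : z <= y -> is_derive y 1 (F d) (F d.+1 y).
  by move=> zy; apply: Fd => //; exact: lt_le_trans zy.
have [|||c cI Ec] := @MVT R (F d) (F d.+1) z (z + h).
- by rewrite ltrDl.
- by move=> y; rewrite in_itv/= => /andP[/ltW zy _]; exact: Fdd.
- apply: derivable_within_continuous => y; rewrite in_itv/= => /andP[zy _].
  by have [] := Fdd y zy.
have /andP[zc cz] : z < c < z + h by move: cI; rewrite in_itv.
exists c; last first.
  rewrite iterSr -/(G 0%N) E /G Ec exprS; ring.
by rewrite (le_trans xz (ltW zc))/= (le_trans (ltW cz))// -natr1 mulrDl mul1r addrA lerD2r.
Qed.

Lemma iter_difference_bound d f h x (C : R) : 0 <= h ->
  (forall y, x <= y <= x + d%:R * h -> `|f y| <= C) ->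
  `|iter d (fun g y => g (y + h) - g y) f x| <= 2 ^+ d * C.
Proof.
move=> h0; elim: d f C => [|d IH] f C fC.
  by rewrite mul1r; apply: fC; rewrite mul0r addr0 lexx.
rewrite iterSr exprSr -mulrA; apply: IH => y /andP[xy yx].
rewrite (le_trans (ler_normB _ _))// mulr_natl mulr2n lerD// fC//.
- rewrite -natr1 mulrDl mul1r addrA lerD2r yx andbT.
  by rewrite (le_trans xy)// lerDl.
- by rewrite xy (le_trans yx)// lerD2l ler_wpM2r// ler_nat.
Qed.

(* [a] being small at the points [t, 2 t, ..., (d + 1) t], its [d]-th difference
   of step [t] yields points where the [d]-th derivative is small; this derivative
   is eventually monotone. *)
Lemma hardy_derive1n_cvg0 a : hardy_union a -> polynomial_growth a ->
  exists d X, [/\ (forall i y, (i <= d)%N -> X < y ->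
      is_derive y 1 (derive1n i a) (derive1n i.+1 a y)),
    (exists2 sg : R, sg ^+ 2 = 1 & forall y, X < y -> 0 <= sg * derive1n d.+1 a y) &
    derive1n d a x @[x --> +oo] --> 0].
Proof.
move=> [H hH Ha] [d d0 a_small]; exists d; pose F i := derive1n i a.
have [X1 F_der] : exists X, forall i y, (i <= d)%N -> X < y -> is_derive y 1 (F i) (F i.+1 y).
  elim: d {d0 a_small} => [|d [X XP]].
    have /pinftyP[X XP] := (hardy_derive hH Ha).1; exists X => -[|//] y _ Xy.
    by apply: DeriveDef; [exact: XP|rewrite /F [in RHS]derive1nS derive1E].
  have /pinftyP[X' XP'] := (hardy_derive hH (hardy_derive1n d.+1 hH Ha)).1.
  exists (Num.max X X') => i y; rewrite gt_max leq_eqVlt => /orP[/eqP ->|id] /andP[Xy Xy'].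
    by apply: DeriveDef; [exact: XP'|rewrite /F [in RHS]derive1nS derive1E].
  exact: XP.
have [sg sg2 /pinftyP[X2 sgP]] := hardy_sign hH (hardy_derive1n d.+1 hH Ha).
pose X := Num.max (Num.max X1 X2) 1.
have X0 : 0 < X by rewrite lt_max ltr01 orbT.
have XX1 : X1 <= X by rewrite !le_max lexx.
have XX2 : X2 <= X by rewrite !le_max lexx orbT.
have Fder i y : (i <= d)%N -> X < y -> is_derive y 1 (F i) (F i.+1 y).
  by move=> id Xy; apply: F_der => //; exact: le_lt_trans Xy.
have sgF y : X < y -> 0 <= sg * F d.+1 y by move=> Xy; apply: sgP; exact: le_lt_trans Xy.
exists X; split; [exact: Fder|by exists sg|].
have mono x y : X < x -> x <= y -> sg * F d x <= sg * F d y.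
  move=> Xx; rewrite le_eqVlt => /predU1P[-> //|xy].
  have Fd z : x <= z -> is_derive z 1 (F d) (F d.+1 z).
    by move=> xz; apply: Fder => //; exact: lt_le_trans xz.
  have [||c cI E] := @MVT R (F d) (F d.+1) x y xy.
  - by move=> z; rewrite in_itv/= => /andP[/ltW zy _]; exact: Fd.
  - apply: derivable_within_continuous => z; rewrite in_itv/= => /andP[zy _].
    by have [] := Fd z zy.
  have /andP[xc _] : x < c < y by move: cI; rewrite in_itv.
  rewrite -subr_ge0 -mulrBr E mulrA mulr_ge0//; last by rewrite subr_ge0 ltW.
  exact/sgF/(lt_trans Xx).
have small e Y : 0 < e -> exists2 z, Y <= z /\ X < z & `|F d z| <= e.
  (* The factor [2 ^+ d] comes from the iterated difference, the other one from evaluating at points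
     up to [d.+1%:R * x]; the powers of the step [x] cancel. *)
  move=> e0; pose K : R := 2 ^+ d * d.+1%:R ^+ d.
  have K0 : 0 < K by rewrite mulr_gt0// exprn_gt0// ltr0n.
  move/cvgr0Pnorm_le : a_small => /(_ (e / K) (divr_gt0 e0 K0)) /pinftyP[X3 X3P].
  pose x := Num.max (Num.max Y X) X3 + 1.
  have : Num.max (Num.max Y X) X3 < x by rewrite ltrDl.
  rewrite gt_max => /andP[+ X3x]; rewrite gt_max => /andP[Yx Xx].
  have x0 : 0 < x := lt_trans X0 Xx.
  have [z /andP[xz zx] E] := @MVT_iter_difference F d X x x0 (fun i y id => Fder i y (ltnW id)) x Xx.
  exists z; first by rewrite (le_trans (ltW Yx) xz) (lt_le_trans Xx xz).
  have xd0 : 0 < x ^+ d by rewrite exprn_gt0.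
  rewrite -(ler_pM2l xd0) -[x ^+ d in leLHS]gtr0_norm// -normrM -E.
  apply: (@le_trans _ _ (2 ^+ d * (e / K * (d.+1%:R * x) ^+ d))).
    apply: iter_difference_bound; first exact: ltW.
    move=> y /andP[xy yx]; have y0 : 0 < y := lt_le_trans x0 xy.
    have := X3P y (lt_le_trans X3x xy).
    have yd0 : 0 < y ^+ d by rewrite exprn_gt0.
    rewrite normrM normfV (gtr0_norm yd0) ler_pdivrMr// => h.
    rewrite (le_trans h)// ler_wpM2l ?(divr_ge0 (ltW e0) (ltW K0))//.
    rewrite ler_pXn2r// ?nnegrE ?(ltW y0) ?mulr_ge0 ?ler0n ?(ltW x0)//.
    by rewrite -natr1 mulrDl mul1r addrC.
  rewrite le_eqVlt; apply/orP; left; apply/eqP; rewrite exprMn /K; field.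
  by rewrite !expf_neq0// pnatr_eq0.
(* By monotonicity [sg * F d] at [x] lies between its values at an earlier and a later point where
   it is small. *)
apply/cvgr0Pnorm_le => e e0; apply/pinftyP.
have [z0 [_ Xz0] z0e] := small e 0 e0; exists z0 => x z0x.
have [z1 [xz1 Xz1] z1e] := small e x e0.
have Xx := lt_trans Xz0 z0x.
have sg1 y : `|sg * y| = `|y|.
  rewrite normrM (_ : `|sg| = 1) ?mul1r//.
  by apply/eqP; rewrite -sqr_norm_eq1 sg2.
move: z0e z1e; rewrite -(sg1 (F d z0)) -(sg1 (F d z1)) -(sg1 (derive1n d a x)).
rewrite !ler_norml => /andP[l0 _] /andP[_ u1].
by rewrite (le_trans l0 (mono _ _ Xz0 (ltW z0x))) (le_trans (mono _ _ Xx xz1) u1).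
Qed.

(** Differences of step 1 are values of derivatives at later points. The origin [n0] stays free so
    that it can be pushed beyond any bound. *)
Lemma hardy_sequence a : hardy_union a -> polynomial_growth a ->
  exists d (sg : R) (N0 : nat), sg ^+ 2 = 1 /\ forall n0, (N0 <= n0)%N ->
    let s n := a (n + n0)%N%:R in
    iter d fdiff s n @[n --> \oo] --> 0 /\ forall n, 0 <= sg * iter d.+1 fdiff s n.
Proof.
move=> Ha ga; have [d [X [Fder [sg sg2 sgF] F0]]] := hardy_derive1n_cvg0 Ha ga.
exists d, sg, (Num.bound X); split=> // n0 Xn0 s.
have Xn n : X < (n + n0)%:R.
  rewrite (lt_le_trans (unstable.ltr_bound X))// ler_nat.
  by rewrite (leq_trans Xn0)// leq_addl.

have E j : (j <= d.+1)%N -> forall n, exists2 z, (n + n0)%:R <= z &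
    iter j fdiff s n = derive1n j a z.
  move=> jd n; have [i y ij Xy|z /andP[nz _] zE] :=
      @MVT_iter_difference (fun i => derive1n i a) j X 1 ltr01 _ _ (Xn n).
    by apply: Fder => //; rewrite -ltnS (leq_trans ij).
  exists z => //; move: zE; rewrite expr1n mul1r => <-.
  elim: j n {jd nz} => //= j IH n; rewrite /fdiff !IH.
  by rewrite addSn natr1.
split=> [|n]; last by have [z nz ->] := E _ (leqnn _) n; apply: sgF; exact: lt_le_trans nz.
apply/cvgr0Pnorm_le => e e0.
move/cvgr0Pnorm_le : F0 => /(_ e e0) /pinftyP[Y YP].
near=> n; have [z nz ->] := E d (leqnSn _) n.
apply: YP; apply: lt_le_trans nz.
rewrite (lt_le_trans (unstable.ltr_bound Y))// ler_nat.
rewrite (@leq_trans n) ?leq_addr//; near: n; exact: nbhs_infty_ge.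
Unshelve. all: by end_near. Qed.
End HardyFields.

(** * Equidistributing weights for a Hardy field function at integers *)

Section HardyEquidistribution.
Context {R : realType}.
Implicit Types (P Q : {poly R}) (s e : nat -> R).

Lemma weight_cst1 : weight (fun=> 1 : R).
Proof.
split => //; apply/cvgryPge => A; near=> N.
rewrite sumr_const card_ord; apply: le_trans (ltW (unstable.ltr_bound A)) _.
by rewrite ler_nat; near: N; exact: nbhs_infty_ge.
Unshelve. all: by end_near. Qed.

Lemma rational_nonconstant_integral P : rational_nonconstant P ->
  exists m (p : {poly int}), (0 < m)%N /\
    map_poly (intr : int -> R) p = m%:R *: (P - (P`_0)%:P).
Proof.
move=> [m m0 mP]; exists m.
exists (\poly_(i < size P) (if i == 0%N then 0 else Num.floor (m%:R * P`_i))).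
split => //; apply/polyP => i; rewrite coef_map/= coef_poly coefZ coefB coefC.
case: ltnP => [_|sP]; last first.
  rewrite nth_default//; case: eqP => [i0|_]; last by rewrite subr0 mulr0.
  have P0 : P`_0 = 0 by apply: nth_default; rewrite -[0%N]i0.
  by rewrite P0 subrr mulr0.
case: eqP => [->|/eqP i0]; first by rewrite subrr mulr0.
by rewrite subr0 floorK// mP// lt0n.
Qed.

(** Otherwise [P] would be, up to a constant, a real multiple of an integer polynomial, to which [a]
    would stay at bounded distance along the integers. *)
Lemma far_polynomial_irrational (a : R -> R) n0 P e theta :
  (forall (p : {poly int}) (c : R),
     `|a x - c * (map_poly (intr : int -> R) p).[x]| @[x --> +oo] --> +oo) ->
  (forall n, a (n + n0)%N%:R = P.[n%:R] + e n) -> e n @[n --> \oo] --> 0 ->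
  theta != 0 -> ~ rational_nonconstant (theta *: P).
Proof.
move=> a_far aE e0 theta0 /rational_nonconstant_integral[m [p [m0 pE]]].
(* The composition undoes the index shift, and [c] removes both [theta] and the common
   denominator. *)
pose q := p \Po ('X - (n0%:Z)%:P).
pose c := (m%:R * theta)^-1.
have c0 : m%:R * theta != 0 by rewrite mulf_neq0// pnatr_eq0 -lt0n.
have qE n : c * (map_poly (intr : int -> R) q).[(n + n0)%N%:R] = P.[n%:R] - P`_0.
  rewrite map_comp_poly horner_comp rmorphB/= map_polyX map_polyC/= hornerXsubC.
  rewrite -[n0%:~R]/(n0%:R) natrD addrK pE coefZ.
  rewrite hornerZ hornerD hornerN hornerC hornerZ /c; field.
  by rewrite theta0 pnatr_eq0 -lt0n m0.
have [X XP] : exists X, forall x, X < x -> `|P`_0| + 2 <= `|a x - c * (map_poly (intr : int -> R) q).[x]|.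
  by apply/pinftyP; move/cvgryPge : (a_far q c); exact.
move/cvgr0Pnorm_le : e0 => /(_ 1 ltr01) [M _ MP].
pose n := maxn M (Num.bound X).
have Xn : X < (n + n0)%N%:R.
  rewrite (lt_le_trans (unstable.ltr_bound X))// ler_nat.
  by rewrite (leq_trans (leq_maxr M _))// leq_addr.
have := XP _ Xn; rewrite qE aE.
have := MP n (leq_maxl _ _).
rewrite (_ : _ - _ = P`_0 + e n); last by ring.
have := ler_normD P`_0 (e n); lra.
Qed.

Lemma hardy_equidistribution (a : R -> R) n0 d (sg : R) :
  let s n := a (n + n0)%N%:R in
  (forall (p : {poly int}) (c : R),
     `|a x - c * (map_poly (intr : int -> R) p).[x]| @[x --> +oo] --> +oo) ->
  sg ^+ 2 = 1 -> iter d fdiff s n @[n --> \oo] --> 0 ->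
  (forall n, 0 <= sg * iter d.+1 fdiff s n) ->
  exists2 w, weight w & forall theta, theta != 0 -> mean_zero w (fun n => theta * s n).
Proof.
move=> s a_far sg2 s0 s_mono.
have [P [e [sE eE]]] := slow_decomposition sg2 s0 s_mono.
have sEt theta : (fun n => theta * s n) =
    (fun n => (theta *: P).[n%:R] + theta * e n).
  by apply/funext => n; rewrite sE hornerZ mulrDr.
case: eE => [e0|[j [tau [b [w [bw tau0 ejb]]]]]].
- exists (fun=> 1); first exact: weight_cst1.
  move=> theta theta0.
  have Z0 : periodic_mod1 1 (fun=> 0 : R) by move=> n; rewrite subrr rpred0.
  have te0 : theta * e n.+1 - theta * e n @[n --> \oo] --> 0.
    under eq_fun do rewrite -[- (theta * e _)]mulN1r.
    apply: cvgD0; last by do 2 apply: cvgZ0.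
    by apply: cvgZ0; move: e0; rewrite -cvg_shiftS.
  have [||] := poly_dichotomy weight_cst1 (leqnn (size (theta *: P))) _ Z0 te0.
  + by [].
  + by move=> h; have := far_polynomial_irrational a_far sE e0 theta0 h.
  + rewrite sEt (_ : (fun n => _ + 0 + _) = fun n => (theta *: P).[n%:R] + theta * e n)//.
    by apply/funext => n; rewrite addr0.
- have [w_wt _ _] := bw; exists w => // theta theta0; rewrite sEt.
  apply: (mean_zero_slow_iter_fdiff _ bw (mulf_neq0 theta0 tau0) (c := 0) (j := j)).
  under eq_fun do rewrite iter_fdiffZ ejb mulrA subrr.
  exact: cvg_cst.
Qed.

End HardyEquidistribution.

(** * Finitely additive measures and sets met infinitely often *)

Section Contents.
Context {R : realType} {T : Type}.
Implicit Types (A B : set T).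

(** Finite additivity in modular form, which needs no disjointness; all subsets are measured. *)
Record content (mu : set T -> R) : Prop := Content {
  content_set0 : mu set0 = 0;
  content_le1 : forall A, mu A <= 1;
  content_le : forall A B, A `<=` B -> mu A <= mu B;
  content_setUI : forall A B, mu (A `|` B) + mu (A `&` B) = mu A + mu B }.

Lemma ultra_cvg (U : set_system nat) (f : nat -> R) : UltraFilter U ->
  (forall i, 0 <= f i <= 1) -> exists l : R, f i @[i --> U] --> l.
Proof.
move=> UU f01; have PU : ProperFilter U by exact: ultra_proper.
have [|l [_ cl]] := @segment_compact R 0 1 (f @ U) _.
  by apply: (@filterE _ U) => i /=; rewrite in_itv/= f01.
exists l => V lV; have [//|UV] := in_ultra_setVsetC (f @^-1` V) UU.
by have [x [nVx Vx]] := cl (~` V) V UV lV.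
Qed.

(** An ultrafilter refining the cofinite one gives limits for all sets at once, and finite
    additivity passes to the limit. *)
Lemma ultralimit_content (sigma : nat -> set T -> R) :
  (forall i, content (sigma i)) ->
  exists2 mu, content mu &
    forall A c, (\forall i \near \oo, c <= sigma i A) -> c <= mu A.
Proof.
move=> sc; have [U [UU ooU]] := @ultraFilterLemma nat \oo _.
have PU : ProperFilter U by exact: ultra_proper.
have s01 A i : 0 <= sigma i A <= 1.
  by rewrite content_le1// andbT -(content_set0 (sc i)) content_le.
have /choice[mu muP] A : exists l : R, sigma i A @[i --> U] --> l.
  by apply: ultra_cvg => i; exact: s01.
exists mu; last first.
  by move=> A c cA; apply: (cvgr_to_ge (muP A)); exact: ooU.
split.
- apply: (cvg_unique _ (muP set0)) => //.
  rewrite (_ : (fun i => _) = fun=> 0); first exact: cvg_cst.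
  by apply/funext => i; rewrite content_set0.
- by move=> A; apply: (cvgr_to_le (muP A)); apply: nearW => i; rewrite content_le1.
- move=> A B AB; rewrite -subr_ge0; apply: (cvgr_to_ge (cvgB (muP B) (muP A))).
  by apply: nearW => i /=; rewrite subr_ge0 content_le.
- move=> A B; apply: (cvg_unique _ (cvgD (muP (A `|` B)) (muP (A `&` B)))) => //.
  have -> : sigma^~ (A `|` B) + sigma^~ (A `&` B) = sigma^~ A + sigma^~ B.
    by apply/funext => i; exact: content_setUI.
  exact: cvgD.
Qed.

Context (mu : set T -> R) (mu_c : content mu) (E : nat -> set T).

Definition recurrent_part (C : set T) := exists2 delta : R, 0 < delta &
  forall K, exists2 k, (K <= k)%N & delta <= mu (C `&` E k).

(* Otherwise one could add up pieces [C `&` E k] of measure at least [delta]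
   with small overlaps until the total exceeds [1]. *)
Lemma recurrent_part_refine C n : recurrent_part C ->
  exists2 k, (n <= k)%N & recurrent_part (C `&` E k).
Proof.
move=> [delta delta0 Cd]; apply: contrapT => nrec.
have small k : (n <= k)%N -> forall eta, 0 < eta ->
    exists K, forall l, (K <= l)%N -> mu (C `&` E k `&` E l) < eta.
  move=> nk eta eta0; apply: contrapT => nK; apply: nrec; exists k => //.
  exists eta => // K; apply: contrapT => nl; apply: nK; exists K => l Kl.
  by rewrite ltNge; apply/negP => h; apply: nl; exists l.
(* The second clause is the invariant: late sets overlap [D] as little as wanted, so that each new
   piece adds at least [delta / 2]. *)
have grow i : exists2 D : set T, i%:R * (delta / 2) <= mu D &
    forall eta, 0 < eta -> exists K, forall l, (K <= l)%N -> mu (D `&` E l) < eta.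
  elim: i => [|i [D Di Dsmall]].
    exists set0; first by rewrite mul0r content_set0.
    by move=> eta eta0; exists 0%N => l _; rewrite set0I content_set0.
  have [K KP] := Dsmall _ (divr_gt0 delta0 (ltr0n R 2)).
  have [l] := Cd (maxn K n); rewrite geq_max => /andP[Kl nl] dl.
  exists (D `|` (C `&` E l)).
    have := content_setUI mu_c D (C `&` E l).
    have := KP l Kl; have : mu (D `&` (C `&` E l)) <= mu (D `&` E l).
      by apply: content_le => // x [Dx [_ Ex]].
    rewrite -[i.+1%:R]natr1 mulrDl mul1r; lra.
  move=> eta eta0; have eta20 : 0 < eta / 2 by rewrite divr_gt0.
  have [K1 K1P] := Dsmall _ eta20; have [K2 K2P] := small l nl _ eta20.
  exists (maxn K1 K2) => l'; rewrite geq_max => /andP[/K1P h1 /K2P h2].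
  rewrite setIUl; have := content_setUI mu_c (D `&` E l') (C `&` E l `&` E l').
  have := content_le mu_c (sub0set (D `&` E l' `&` (C `&` E l `&` E l'))).
  rewrite content_set0//; lra.
pose i := Num.bound (2 / delta).
have [D iD _] := grow i.
have := unstable.ltr_bound (2 / delta); rewrite -/i ltr_pdivrMr// => h.
have := content_le1 mu_c D; lra.
Qed.

End Contents.

(* A point lying in infinitely many of the [E k] is obtained as a point of a
   decreasing sequence of compact finite intersections of positive measure. *)
Lemma content_limsup {R : realType} (mu : set R -> R) (E : nat -> set R) (delta : R) :
  content mu -> 0 < delta -> (forall k, closed (E k)) ->
  (forall k, E k `<=` `[0, 1]) -> (forall k, delta <= mu (E k)) ->
  exists x, forall K, exists2 k, (K <= k)%N & E k x.
Proof.
move=> mu_c delta0 Ecl E01 Emu.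
(* The second component bounds the next index from below, so the chosen indices increase
   strictly. *)
pose step (X Y : set R * nat) := recurrent_part mu E X.1 -> recurrent_part mu E Y.1 /\
  exists k, [/\ (X.2 <= k)%N, Y.1 = X.1 `&` E k & Y.2 = k.+1].
have /dependent_choice H X : {Y | step X Y}.
  apply: cid; have [rX|nX] := pselect (recurrent_part mu E X.1); last by exists X.
  have [k Xk rk] := recurrent_part_refine mu_c X.2 rX.
  by exists (X.1 `&` E k, k.+1) => _; split=> //; exists k.
have [C [C0 Cstep]] := H (`[0, 1]%classic, 0%N).
have Crec i : recurrent_part mu E (C i).1.
  elim: i => [|i IH]; last exact: (Cstep i IH).1.
  rewrite C0; exists delta => // K; exists K => //=.
  by rewrite setIidr.
have Cnext i := (Cstep i (Crec i)).2.
have Csub i j : (i <= j)%N -> (C j).1 `<=` (C i).1.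
  move=> /subnKC <-; elim: (j - i)%N => [|m IH]; first by rewrite addn0.
  rewrite addnS; have [k [_ -> _]] := Cnext (i + m)%N.
  by apply: subset_trans IH; exact: subIsetl.
have Cclosed i : closed (C i).1.
  elim: i => [|i IH]; first by rewrite C0; exact: interval_closed.
  by have [k [_ -> _]] := Cnext i; exact: closedI.
have Cge i : (i <= (C i).2)%N.
  elim: i => [//|i IH]; have [k [Ck _ ->]] := Cnext i.
  by rewrite ltnS (leq_trans IH).
have /choice[x xC] i : exists x, (C i).1 x.
  have [eta eta0 /(_ 0%N)[k _ h]] := Crec i.
  apply: contrapT => nx; have : mu ((C i).1 `&` E k) = 0.
    rewrite -(content_set0 mu_c); congr mu; rewrite -subset0 => y [Cy _].
    by apply: nx; exists y.
  by move: h => /[swap] ->; rewrite leNgt eta0.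
have [|y [_ cly]] := @segment_compact R 0 1 (x @ \oo) _.
  by apply: (@filterE _ \oo) => i; have := Csub _ _ (leq0n i) _ (xC i); rewrite C0.
have yC i : (C i).1 y.
  apply: Cclosed => V /cly; apply; exists i => // j /= ij.
  exact: Csub ij _ (xC j).
exists y => K; have [k [Kk CE _]] := Cnext K.
exists k; first exact: leq_trans Kk.
by have := yC K.+1; rewrite CE => -[].
Qed.

(** * Discrete spectral measures of finite sets of integers *)

Section SpectralMeasure.
Context {R : realType}.
Implicit Types (B : seq int) (z d : int) (M N j : nat).

(** Orthogonality of characters mod [M]; the bound on [z] makes 0 the only multiple of [M] allowed.
    Increments over a full period sum to 0, which yields a nonsingular linear system for the cosine
    and sine sums. *)
Lemma sum_ecos_period M z : `|z| < M%:Z ->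
  \sum_(j < M) ecos (z%:~R * (j%:R / M%:R)) = (if z == 0 then M%:R else 0) :> R.
Proof.
move=> zM; have [->|z0] := eqVneq z 0.
  rewrite (eq_bigr (fun=> 1)) ?sumr_const ?card_ord// => j _.
  by rewrite mul0r ecos0.
have M0 : (0 < M)%N by move: zM; case: M => //; rewrite normr_lt0.
have MR0 : M%:R != 0 :> R by rewrite pnatr_eq0 -lt0n.
pose t : R := z%:~R / M%:R.
have tE j : z%:~R * (j%:R / M%:R) = t * j%:R by rewrite /t; field.
pose c := 1 - ecos t; pose s := esin t.
pose C := \sum_(j < M) ecos (t * j%:R); pose S := \sum_(j < M) esin (t * j%:R).
have tM : t * M%:R = z%:~R by rewrite /t divfK.
have C0 : c * C + s * S = 0.
  have := sum_fdiff (fun j => ecos (t * j%:R)) 0 M.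
  rewrite add0n tM mulr0 -[z%:~R]add0r ecos_addz subrr => E.
  apply/eqP; rewrite -oppr_eq0 -[X in _ == X]E !mulr_sumr -big_split/= -sumrN.
  apply/eqP/eq_bigr => j _; rewrite add0n /fdiff -[j.+1%:R]natr1 mulrDr mulr1 ecosD /c /s; ring.
have S0 : c * S - s * C = 0.
  have := sum_fdiff (fun j => esin (t * j%:R)) 0 M.
  rewrite add0n tM mulr0 -[z%:~R]add0r esin_addz subrr => E.
  apply/eqP; rewrite -oppr_eq0 -[X in _ == X]E !mulr_sumr -sumrB -sumrN.
  apply/eqP/eq_bigr => j _; rewrite add0n /fdiff -[j.+1%:R]natr1 mulrDr mulr1 esinD /c /s; ring.
have c0 : c != 0.
  rewrite subr_eq0; apply/eqP => /esym/ecos_eq1_int/intrP[k tk].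
  have zk : z = k * M%:Z.
    by apply/eqP; rewrite -(eqr_int R) -tM tk rmorphM.
  have k0 : k != 0 by apply: contra_neq z0 => k0; rewrite zk k0 mul0r.
  move: zM; rewrite zk normrM ltNge ler_peMl//.
  by rewrite -gtz0_ge1 normr_gt0.
have D0 : c ^+ 2 + s ^+ 2 != 0.
  by rewrite paddr_eq0 ?sqr_ge0// !expf_eq0/= negb_and c0.
under eq_bigr do rewrite tE; rewrite -/C.
have : (c ^+ 2 + s ^+ 2) * C = c * (c * C + s * S) - s * (c * S - s * C) by ring.
rewrite C0 S0 !mulr0 subrr => /eqP; rewrite mulf_eq0 (negbTE D0)/=.
by move/eqP.
Qed.

(* The squared modulus of the discrete Fourier transform of the indicator of [B]
   at the frequency [j / M], normalized to have total mass [1]. *)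
Definition spectral B M j : R := (M%:R * (size B)%:R)^-1 *
  ((\sum_(x <- B) ecos (x%:~R * (j%:R / M%:R))) ^+ 2 +
   (\sum_(x <- B) esin (x%:~R * (j%:R / M%:R))) ^+ 2).

Lemma spectral_ge0 B M j : 0 <= spectral B M j.
Proof. by rewrite mulr_ge0 ?invr_ge0 ?mulr_ge0// addr_ge0 ?sqr_ge0. Qed.

(** This atom at frequency 0 is where the density of the set enters. *)
Lemma spectral0 B M : spectral B M 0 = (size B)%:R / M%:R.
Proof.
rewrite /spectral mul0r.
have -> : \sum_(x <- B) ecos (x%:~R * 0) = (size B)%:R :> R.
  rewrite (eq_bigr (fun=> 1)) ?big_const_seq ?count_predT ?iter_addr_0// => x _.
  by rewrite mulr0 ecos0.
have -> : \sum_(x <- B) esin (x%:~R * 0) = 0 :> R.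
  by rewrite big1// => x _; rewrite mulr0 /esin mulr0 sin0.
have [->|B0] := eqVneq ((size B)%:R : R) 0; first by rewrite !mul0r expr0n addr0 mulr0.
have [->|M0] := eqVneq (M%:R : R) 0; first by rewrite mul0r invr0 mul0r mulr0.
by field; rewrite B0 M0.
Qed.

(** Expanding the square leaves the frequencies [x - y + d] and [x - y - d]; the bound excludes
    wrapping around mod [M]. *)
Lemma sum_spectral B M d :
  (forall x y, x \in B -> y \in B -> `|x - y| + `|d| < M%:Z) ->
  \sum_(j < M) spectral B M j * ecos (d%:~R * (j%:R / M%:R)) =
  (size B)%:R^-1 * \sum_(x <- B) \sum_(y <- B)
    ((x - y + d == 0)%:R + (x - y - d == 0)%:R) / 2.
Proof.
move=> BM; have [M0|M0] := posnP M.
  rewrite M0 big_ord0 [X in _ * X]big1_seq ?mulr0// => x /= xB.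
  have := BM x x xB xB; rewrite M0 ltNge addr_ge0//.
have MR0 : M%:R != 0 :> R by rewrite pnatr_eq0 -lt0n.
pose e z j : R := ecos (z%:~R * (j%:R / M%:R)).
have sE j : spectral B M j * e d j = (size B)%:R^-1 *
    \sum_(x <- B) \sum_(y <- B) M%:R^-1 * ((e (x - y + d) j + e (x - y - d) j) / 2).
  rewrite /spectral invfM -!mulrA mulrCA; congr (_ * _).
  rewrite !expr2 !mulr_suml -big_split/= mulr_suml mulr_sumr.
  apply: eq_bigr => x _; rewrite !mulr_sumr -big_split/= mulr_suml mulr_sumr.
  apply: eq_bigr => y _; congr (_ * _).
  by rewrite -ecosB -mulrBl -rmorphB/= ecosM -mulrDl -mulrBl -rmorphD/= -rmorphB.
under eq_bigr do rewrite -/(e d _) sE.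
rewrite -mulr_sumr exchange_big/=; congr (_ * _).
rewrite big_seq [RHS]big_seq; apply: eq_bigr => x xB.
rewrite exchange_big/= big_seq [RHS]big_seq; apply: eq_bigr => y yB.
rewrite -mulr_sumr -mulr_suml big_split/= !sum_ecos_period.
- by do 2 case: eqP => _ /=; field.
- by apply: le_lt_trans (ler_normB _ _) (BM _ _ xB yB).
- by apply: le_lt_trans (ler_normD _ _) (BM _ _ xB yB).
Qed.

Lemma sum_spectral1 B M : uniq B -> (0 < size B)%N ->
  (forall x y, x \in B -> y \in B -> `|x - y| < M%:Z) ->
  \sum_(j < M) spectral B M j = 1.
Proof.
move=> Bu B0 BM.
have -> : \sum_(j < M) spectral B M j =
    \sum_(j < M) spectral B M j * ecos (0%:~R * (j%:R / M%:R)).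
  by apply: eq_bigr => j _; rewrite mul0r ecos0 mulr1.
rewrite sum_spectral; last by move=> x y xB yB; rewrite normr0 addr0 BM.
rewrite (eq_big_seq (fun=> 1)); last first.
  move=> x xB; under eq_bigr do rewrite !addr0 subr_eq0.
  rewrite (bigD1_seq x)//= eqxx big1 ?addr0; first by rewrite /=; field.
  by move=> y yx; rewrite eq_sym (negbTE yx) addr0 mul0r.
by rewrite big_const_seq count_predT iter_addr_0 mulVf// pnatr_eq0 -lt0n.
Qed.

Lemma sum_spectral_eq0 B M d :
  (forall x y, x \in B -> y \in B -> `|x - y| + `|d| < M%:Z) ->
  (forall x y, x \in B -> y \in B -> y - x != d) ->
  \sum_(j < M) spectral B M j * ecos (d%:~R * (j%:R / M%:R)) = 0.
Proof.
move=> BM Bd; rewrite sum_spectral// big1_seq ?mulr0// => x /= xB.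
rewrite big1_seq// => y /= yB.
rewrite -[x - y + d]opprK oppr_eq0 opprD opprB !subr_eq0.
by rewrite (negbTE (Bd _ _ xB yB)) (negbTE (Bd _ _ yB xB)) addr0 mul0r.
Qed.

End SpectralMeasure.

(** * From averages over the differences to differences in dense sets *)

Section Intersectivity.
Context {R : realType}.
Implicit Types (L : set int) (B : seq int) (N M k n i j : nat).

Definition window L N : seq int :=
  fset_set (L `&` [set k : int | - N%:Z <= k <= N%:Z]).

Lemma finite_int_segment N : finite_set [set k : int | - N%:Z <= k <= N%:Z].
Proof.
apply: (@sub_finite_set _ _ ((fun i : nat => i%:Z - N%:Z) @` `I_(2 * N).+1)).
  move=> k /andP[k1 k2]; exists (absz (k + N%:Z)); last by lia.
  by rewrite /=; lia.
exact/finite_image/finite_II.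
Qed.

Lemma mem_window L N x : (x \in window L N) = (x \in L) && (`|x| <= N%:Z).
Proof.
rewrite /window in_fset_set; last exact: (sub_finite_set (@subIsetr _ _ _) (finite_int_segment N)).
by rewrite in_setI ler_norml; congr (_ && _); apply/idP/idP => [/set_mem|/mem_set].
Qed.

Lemma upper_density_gt0 L : (0 < upper_density R L)%E ->
  exists2 delta : R, 0 < delta & forall N0, exists2 N, (N0 <= N)%N &
    delta * (2 * N + 1)%:R <= (size (window L N))%:R.
Proof.
move=> dL; apply: contrapT => nd.
have : (upper_density R L <= 0)%E; last by rewrite leNgt dL.
apply/lee_addgt0Pr => e e0; rewrite add0e.
have [N0 N0P] : exists N0, forall N, (N0 <= N)%N ->
    (size (window L N))%:R < e * (2 * N + 1)%:R.
  apply: contrapT => nN; apply: nd; exists e => // N0; apply: contrapT => nN0.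
  apply: nN; exists N0 => N NN0; rewrite ltNge; apply/negP => h.
  by apply: nN0; exists N.
rewrite /upper_density /limn_esup /limf_esup.
apply: ge_ereal_inf; eexists; first by exists [set N | (N0 <= N)%N] => //; exists N0.
apply: ge_ereal_sup => _ [N /= NN0 <-].
by rewrite lee_fin ler_pdivrMr ?ltr0n ?addn1// ltW// -addn1 N0P.
Qed.

(** The lower bound on averages is not uniform in [theta], so a single [theta] that is bad
    infinitely often is needed; [content_limsup] provides it. *)
Lemma intersective_of_averages L (d : nat -> int) :
  (0 < upper_density R L)%E ->
  (forall eps : R, 0 < eps -> exists c : nat -> nat -> R,
    [/\ forall N n, 0 <= c N n,
        \forall N \near \oo, \sum_(n < N) c N n = 1 &
        forall theta, 0 <= theta <= 1 ->
          \forall N \near \oo, - eps <= \sum_(n < N) c N n * ecos (theta * (d n)%:~R)]) ->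
  exists x y n, [/\ L x, L y & y - x = d n].
Proof.
move=> /upper_density_gt0[delta delta0 dense] avgs; apply: contrapT => nodiff.
have {}nodiff x y n : L x -> L y -> y - x != d n.
  by move=> Lx Ly; apply/eqP => xy; apply: nodiff; exists x, y, n.
have eps0 : 0 < delta / 8 by rewrite divr_gt0.
have [c [c_ge0 [k0 _ c1] cT]] := avgs _ eps0.
pose T k theta := \sum_(n < k) c k n * ecos (theta * (d n)%:~R).
have /choice[Ns NsP] i : exists N, (i <= N)%N /\ delta * (2 * N + 1)%:R <= (size (window L N))%:R.
  by have [N iN dN] := dense i; exists N.
(* [M i] is twice the length of the window: differences in [B i] are at most [2 * Ns i], which
   leaves room for a shift of size [Ns i], and the atom at 0 keeps half of the density. *)
pose B i := window L (Ns i); pose M i := (4 * Ns i + 2)%N.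
pose pt i j : R := j%:R / (M i)%:R.
have Mgt0 i : (0 < M i)%N by rewrite /M addn2.
have Bgt0 i : (0 < size (B i))%N.
  have [_] := NsP i; rewrite lt0n; apply: contraTneq => ->.
  by rewrite -ltNge mulr_gt0// ltr0n addn1.
have Bdist i x y : x \in B i -> y \in B i -> `|x - y| <= 2 * (Ns i)%:Z.
  rewrite !mem_window => /andP[_ hx] /andP[_ hy].
  by rewrite (le_trans (ler_normB _ _))// mulr_natl mulr2n lerD.
have s1 i : \sum_(j < M i) spectral (B i) (M i) j = 1 :> R.
  apply: sum_spectral1 => // [|x y xB yB]; first exact: fset_uniq.
  by have := Bdist i x y xB yB; rewrite /M; lia.
pose sigma i (A : set R) : R := \sum_(j < M i) spectral (B i) (M i) j * \1_A (pt i j).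
have sigma_content i : content (sigma i).
  split.
  - by rewrite /sigma big1// => j _; rewrite indicE in_set0 mulr0.
  - move=> A; rewrite -(s1 i); apply: ler_sum => j _.
    by rewrite ler_piMr ?spectral_ge0// indicE; case: (_ \in _).
  - move=> A A' AA'; apply: ler_sum => j _; rewrite ler_wpM2l ?spectral_ge0// !indicE ler_nat.
    by case: (boolP (_ \in A)) => // /set_mem/AA' /mem_set ->.
  - move=> A A'; rewrite -!big_split/=; apply: eq_bigr => j _.
    by rewrite -!mulrDr !indicE in_setU in_setI; do 2 case: (_ \in _); rewrite /= ?addr0 ?add0r.
have [mu mu_c muP] := ultralimit_content sigma_content.
(* The bad frequencies; from [k0] on the coefficients sum to 1. *)
pose E k : set R := `[0, 1]%classic `&` [set theta | T (k + k0)%N theta <= - (delta / 4)].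
have Emu k : delta / 4 <= mu (E k).
  apply: muP; pose D := (\sum_(n < k + k0) absz (d n))%N.
  exists D => // i /= Di; pose K := (k + k0)%N.
  have Dn n : (n < K)%N -> (absz (d n) <= Ns i)%N.
    move=> nK; apply: leq_trans (NsP i).1; apply: leq_trans Di.
    by rewrite /D (bigD1 (Ordinal nK))//= leq_addr.
  have T0 : \sum_(j < M i) spectral (B i) (M i) j * T K (pt i j) = 0.
    under eq_bigr do rewrite /T mulr_sumr.
    rewrite exchange_big/= big1// => n _.
    under eq_bigr do rewrite mulrCA [pt i _ * _]mulrC.
    rewrite -mulr_sumr sum_spectral_eq0 ?mulr0//.
      move=> x y xB yB; have := Bdist i x y xB yB; have := Dn n (ltn_ord n).
      by rewrite /M; lia.
    move=> x y; rewrite !mem_window => /andP[/set_mem Lx _] /andP[/set_mem Ly _].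
    exact: nodiff.
  have cK : \sum_(n < K) c K n = 1 by apply: c1; rewrite /= leq_addl.
  have Tge x : -1 <= T K x.
    rewrite -cK -sumrN; apply: ler_sum => n _.
    have := ecos_norm_le1 (x * (d n)%:~R); rewrite ler_norml => /andP[h _].
    by rewrite -mulrN1 ler_wpM2l.
  have Tpt0 : T K 0 = 1.
    by rewrite -[RHS]cK; apply: eq_bigr => n _; rewrite mul0r ecos0 mulr1.
  have pt01 j : (j < M i)%N -> 0 <= pt i j <= 1.
    move=> jM; rewrite divr_ge0//= ler_pdivrMr ?ltr0n//.
    by rewrite mul1r ler_nat ltnW.
  (* Integrated against the spectral measure, which annihilates [T K], this bounds the atom at 0 by
     [delta / 4] plus the mass of [E k]; the atom being at least [delta / 2], that mass is at least
     [delta / 4]. *)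
  have key j : (j < M i)%N -> (if j == 0%N then 1 else 0) - delta / 4 - \1_(E k) (pt i j) <= T K (pt i j).
    move=> jM; have := Tge (pt i j); rewrite indicE.
    case: eqP => [->|_]; first by rewrite /pt mul0r Tpt0; case: (_ \in _) => /=; lra.
    case: (boolP (_ \in E k)) => /= [_|]; first by lra.
    rewrite notin_setE /E => /not_andP[|/negP]; first by rewrite /= in_itv/= pt01.
    by rewrite -ltNge -/K; lra.
  have : \sum_(j < M i) spectral (B i) (M i) j *
      ((if (j : nat) == 0%N then 1 else 0) - delta / 4 - \1_(E k) (pt i j)) <= 0.
    rewrite -[leRHS]T0; apply: ler_sum => j _.
    by rewrite ler_wpM2l ?spectral_ge0// key.
  rewrite (_ : \sum_(j < M i) _ = spectral (B i) (M i) 0 - delta / 4 - sigma i (E k)); last first.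
    under eq_bigr do rewrite !mulrBr.
    rewrite !sumrB -mulr_suml s1 mul1r; congr (_ - _ - _).
    rewrite (bigD1 (Ordinal (Mgt0 i)))//= mulr1 big1 ?addr0// => j.
    by rewrite -val_eqE/= => /negbTE ->; rewrite mulr0.
  have : delta / 2 <= spectral (B i) (M i) 0.
    rewrite spectral0 ler_pdivlMr ?ltr0n//; have [_] := NsP i.
    apply: le_trans; rewrite /M -[leLHS]mulrA ler_pM2l//.
    rewrite (_ : (4 * Ns i + 2)%N = (2 * (2 * Ns i + 1))%N); last by lia.
    by rewrite natrM mulKf.
  lra.
have Tcont k : continuous (T k).
  move=> x; apply: cvg_sumr => n; apply: cvgMr; rewrite /ecos.
  apply: (@continuous_comp _ _ _ (fun x : R => 2 * pi * (x * (d n)%:~R)) cos); last exact: continuous_cos.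
  by apply: cvgMr; apply: cvgMl; exact: cvg_id.
have Eclosed k : closed (E k).
  apply: closedI; first exact: interval_closed.
  rewrite (_ : [set _ | _] = T (k + k0)%N @^-1` [set x | x <= - (delta / 4)])//.
  by apply: (continuous_closedP _).1 => //; exact: closed_le.
have [theta thetaP] : exists x, forall K, exists2 k, (K <= k)%N & E k x.
  by apply: (content_limsup mu_c _ Eclosed _ Emu); [rewrite divr_gt0|move=> k x []].
have theta01 : 0 <= theta <= 1.
  by have [k _ [+ _]] := thetaP 0%N; rewrite /= in_itv.
have [K _ KP] := cT _ theta01.
have [k Kk [_ /= Tk]] := thetaP K.
have := KP (k + k0)%N (leq_trans Kk (leq_addr _ _)); rewrite /= -/(T _ _); lra.
Qed.
End Intersectivity.

(** * Passing to integer parts with Fejer kernels *)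

Section IntegerParts.
Context {R : realType}.
Implicit Types (u v theta : R) (M n N i j : nat).

(** Written as a squared modulus, the kernel is visibly nonnegative; [fejerE] gives its Fourier
    expansion. *)
Definition fejer M u : R := M%:R^-1 *
  ((\sum_(i < M) ecos (i%:R * u)) ^+ 2 + (\sum_(i < M) esin (i%:R * u)) ^+ 2).

Lemma fejer_ge0 M u : 0 <= fejer M u.
Proof. by rewrite mulr_ge0// addr_ge0 ?sqr_ge0. Qed.

Lemma fejerE M u theta : fejer M u * ecos (theta * u) =
  M%:R^-1 * \sum_(i < M) \sum_(j < M)
    2^-1 * (ecos ((i%:R - j%:R + theta) * u) + ecos ((i%:R - j%:R - theta) * u)).
Proof.
rewrite /fejer -mulrA !expr2 !mulr_suml -big_split/= mulr_suml; congr (_ * _).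
apply: eq_bigr => i _; rewrite !mulr_sumr -big_split/= mulr_suml.
apply: eq_bigr => j _.
by rewrite -ecosB ecosM -!mulrBl -!mulrDl mulrC.
Qed.

(** For close [u] and [v] the Lipschitz bound gives [eps]; otherwise [1 - ecos (u - v)] is bounded
    below, and [C] times it exceeds the trivial bound 2. *)
Lemma dist_ecos_le (eps : R) : 0 < eps -> exists2 C, 0 <= C & forall theta u v,
  0 <= theta <= 1 -> `|u - v| <= 2^-1 -> `|ecos (theta * u) - ecos (theta * v)| <= eps + C * (1 - ecos (u - v)).
Proof.
move=> eps0; have p0 : 0 < 2 * pi :> R by rewrite mulr_gt0// pi_gt0.
pose eta := Num.min (eps / (2 * pi)) 2^-1.
have eta0 : 0 < eta by rewrite lt_min divr_gt0//= invr_gt0.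
have eta2 : eta <= 2^-1 by rewrite ge_min lexx orbT.
have in0pi (x : R) : 0 <= x -> x <= 2^-1 -> 2 * pi * x \in `[0, pi].
  move=> x0 x2; rewrite in_itv/= mulr_ge0 ?(ltW p0)//=.
  by rewrite mulrAC ger_pMl ?pi_gt0//; lra.
have kappa0 : 0 < 1 - ecos eta.
  rewrite subr_gt0 -[X in _ < X]cos0 ltr_cos ?in0pi ?(ltW eta0)//; first by rewrite mulr_gt0.
  by rewrite in_itv/= lexx pi_ge0.
exists (2 / (1 - ecos eta)); first by rewrite divr_ge0// ltW.
move=> theta u v /andP[th0 th1] uv.
have [small|large] := leP `|u - v| eta.
  rewrite ler_wpDr//.
    rewrite mulr_ge0 ?divr_ge0 ?(ltW kappa0)// subr_ge0.
    exact: le_trans (ler_norm _) (ecos_norm_le1 _).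
  rewrite (le_trans (ler_dist_ecos _ _))// -mulrBr normrM ger0_norm//.
  rewrite (@le_trans _ _ (2 * pi * (1 * eta)))//.
    by rewrite ler_wpM2l ?(ltW p0)// ler_pM.
  by rewrite mul1r mulrC -ler_pdivlMr// ge_min lexx.
rewrite (@le_trans _ _ 2)//.
  by rewrite (le_trans (ler_normB _ _))// (natrD _ 1 1) lerD ?ecos_norm_le1.
rewrite ler_wpDl ?(ltW eps0)// mulrAC ler_pdivlMr// ler_wpM2l//.
rewrite lerD2l lerN2.
have -> : ecos (u - v) = ecos `|u - v|.
  by case: (ger0P (u - v)) => // _; rewrite ecosN.
by rewrite le_eqVlt ltr_cos ?in0pi ?(ltW eta0)// ltr_pM2l// large orbT.
Qed.

Context (w s : nat -> R) (w_wt : weight w).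
Context (s_mean_zero : forall theta, theta != 0 -> mean_zero w (fun n => theta * s n)).

Let u n := s n - 2^-1.
Let kappa M n := fejer M (u n).

Lemma cvg_avg_ecos theta :
  avg w (fun n => ecos (theta * u n)) N @[N --> \oo] --> ((theta == 0)%:R : R).
Proof.
have [->|theta0] := eqVneq theta 0.
  rewrite (_ : (fun n => ecos _) = fun=> 1); first exact: cvg_avg_cst.
  by apply/funext => n; rewrite mul0r ecos0.
rewrite (_ : (fun n => ecos _) = fun n => ecos (theta * s n + - (theta / 2))).
  by case: (mean_zero_addc (- (theta / 2)) (s_mean_zero theta0)).
by apply/funext => n; rewrite mulrBr.
Qed.

Lemma cvg_avg_fejer M theta :
  avg w (fun n => kappa M n * ecos (theta * u n)) N @[N --> \oo] -->
  (M%:R^-1 * \sum_(i < M) \sum_(j < M)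
    2^-1 * ((i%:R - j%:R + theta == 0)%:R + (i%:R - j%:R - theta == 0)%:R) : R).
Proof.
rewrite (_ : (fun n => kappa M n * _) = fun n => M%:R^-1 * \sum_(i < M) \sum_(j < M)
    2^-1 * (ecos ((i%:R - j%:R + theta) * u n) + ecos ((i%:R - j%:R - theta) * u n))); last first.
  by apply/funext => n; rewrite -fejerE.
under eq_fun do rewrite avgZ avg_sum.
apply: cvgMr; apply: cvg_sumr => i; under eq_fun do rewrite avg_sum.
apply: cvg_sumr => j; under eq_fun do rewrite avgZ avgD.
by apply: cvgMr; apply: cvgD; exact: cvg_avg_ecos.
Qed.

Lemma natB_eq0 i j : (i%:R - j%:R + 0 == 0 :> R) = (i == j).
Proof. by rewrite addr0 subr_eq0 eqr_nat. Qed.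

Lemma cvg_avg_fejer0 M : (0 < M)%N -> avg w (kappa M) N @[N --> \oo] --> (1 : R).
Proof.
move=> M0; have := @cvg_avg_fejer M 0.
rewrite (_ : (fun n => kappa M n * _) = kappa M); last first.
  by apply/funext => n; rewrite mul0r ecos0 mulr1.
rewrite (eq_bigr (fun=> 1)); last first.
  move=> i _; rewrite (bigD1 i)//= oppr0 natB_eq0 eqxx big1 ?addr0; first by rewrite /=; field.
  by move=> j ji; rewrite natB_eq0 eq_sym (negbTE (ji : (j : nat) != i)) addr0 mulr0.
by rewrite sumr_const card_ord mulVf// pnatr_eq0 -lt0n.
Qed.

(** There are [M - 1] pairs with [i - j = 1] and as many with [i - j = -1]. Hence [1 - ecos (u n)]
    has limiting kernel average [1 / M]: the kernel concentrates where [u n] is near an integer. *)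
Lemma cvg_avg_fejer1 M : (0 < M)%N ->
  avg w (fun n => kappa M n * ecos (u n)) N @[N --> \oo] --> (1 - M%:R^-1 : R).
Proof.
move=> M0; have := @cvg_avg_fejer M 1.
rewrite (_ : (fun n => kappa M n * _) = fun n => kappa M n * ecos (u n)); last first.
  by apply/funext => n; rewrite mul1r.
have nS i j : (i%:R - j%:R + 1 == 0 :> R) = (j == i.+1).
  by rewrite addrAC natr1 subr_eq0 eqr_nat eq_sym.
have Sn i j : (i%:R - j%:R - 1 == 0 :> R) = (i == j.+1).
  by rewrite -addrA -opprD natr1 subr_eq0 eqr_nat.
have M_count : \sum_(i < M) \sum_(j < M) (j == i.+1 :> nat)%:R = M%:R - 1 :> R.
  case: M M0 => // M _; rewrite big_ord_recr/= [X in _ + X]big1 ?addr0; last first.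
    by move=> j _; rewrite ltn_eqF.
  rewrite (eq_bigr (fun=> 1)); first by rewrite sumr_const card_ord -natr1 addrK.
  move=> i _; rewrite (bigD1 (lift ord0 i))//= eqxx big1 ?addr0// => j.
  by rewrite -val_eqE/= => /negbTE ->.
rewrite (_ : \sum_(i < M) _ = M%:R - 1) => [|].
  by rewrite mulrBr mulr1 mulVf// pnatr_eq0 -lt0n.
under eq_bigr do under eq_bigr do rewrite nS Sn mulrDr.
under eq_bigr do rewrite big_split/= -!mulr_sumr.
by rewrite big_split/= -!mulr_sumr M_count exchange_big/= M_count; field.
Qed.

Lemma cvg_avg_fejer_fract M theta : 0 < theta < 1 ->
  avg w (fun n => kappa M n * ecos (theta * u n)) N @[N --> \oo] --> (0 : R).
Proof.
move=> /andP[th0 th1]; have := @cvg_avg_fejer M theta.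
rewrite big1 ?mulr0// => i _; rewrite big1// => j _.
have nint (k : int) : theta != k%:~R.
  apply/eqP => thk; move: th0 th1; rewrite thk ltr0z ltrz1; lia.
have -> : i%:R - j%:R + theta == 0 = false.
  apply: contraNF (nint (j%:Z - i%:Z)); rewrite addrC addr_eq0 => /eqP ->.
  by rewrite rmorphB/= opprB.
have -> : i%:R - j%:R - theta == 0 = false.
  apply: contraNF (nint (i%:Z - j%:Z)); rewrite subr_eq0 => /eqP <-.
  by rewrite rmorphB.
by rewrite addr0 mulr0.
Qed.

(* The weights [kappa M n] favour the [n] for which the fractional part of [s n]
   is close to [1/2]; for these the floor of [s n] is nearly [u n], and the
   integer part disappears from the averages. *)
Lemma averages_of_floor (eps : R) : 0 < eps -> exists c : nat -> nat -> R,
  [/\ forall N n, 0 <= c N n,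
      \forall N \near \oo, \sum_(n < N) c N n = 1 &
      forall theta, 0 <= theta <= 1 -> \forall N \near \oo,
        - eps <= \sum_(n < N) c N n * ecos (theta * (Num.floor (s n))%:~R)].
Proof.
move=> eps0; have e8 : 0 < eps / 8 by rewrite divr_gt0.
have [C C0 CP] := dist_ecos_le e8.
pose M := (Num.bound (8 * C / eps)).+1.
have M0 : 0 < M%:R :> R by rewrite ltr0n.
have CM : C / M%:R <= eps / 8.
  rewrite ler_pdivrMr// mulrAC ler_pdivlMr//; have := unstable.ltr_bound (8 * C / eps).
  rewrite ltr_pdivrMr// => /ltW h; rewrite mulrC (le_trans h)// mulrC ler_wpM2l ?(ltW eps0)//.
  by rewrite ler_nat.
have kappa_ge0 n : 0 <= kappa M n by exact: fejer_ge0.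
pose a := avg w (kappa M).
pose b theta := avg w (fun n => kappa M n * ecos (theta * (Num.floor (s n))%:~R)).
have a1 : a N @[N --> \oo] --> (1 : R) by exact: cvg_avg_fejer0.
have a_gt : \forall N \near \oo, 2^-1 < a N.
  by apply: (cvgr_gt _ a1); rewrite invf_lt1// ltr1n.
have cE N (x : nat -> R) : 2^-1 < a N ->
    \sum_(n < N) (w n * kappa M n / \sum_(m < N) w m * kappa M m) * x n =
    avg w (fun n => kappa M n * x n) N / a N.
  move=> aN; have W0 : \sum_(n < N) w n != 0.
    by apply: contraTneq aN => W0; rewrite /a /avg W0 invr0 mulr0 -leNgt invr_ge0.
  have K0 : \sum_(m < N) w m * kappa M m != 0.
    by apply: contraTneq aN => K0; rewrite /a /avg K0 mul0r -leNgt invr_ge0.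
  rewrite /a /avg invfM invrK mulrACA mulVf// mulr1 mulr_suml.
  by apply: eq_bigr => n _; rewrite [w n * (_ * _)]mulrA mulrAC.
exists (fun N n => w n * kappa M n / \sum_(m < N) w m * kappa M m); split.
- have wk n : 0 <= w n * kappa M n := mulr_ge0 (weight_ge0 w_wt n) (kappa_ge0 n).
  by move=> N n; apply: divr_ge0 => //; apply: sumr_ge0.
- apply: filterS a_gt => N aN; have := cE N (fun=> 1) aN.
  under eq_bigr do rewrite mulr1.
  move=> ->; rewrite (_ : (fun n => kappa M n * 1) = kappa M); last by apply/funext => n; rewrite mulr1.
  by rewrite divff// gt_eqF// (lt_trans _ aN)// invr_gt0.
move=> theta th01.
have b_ge : \forall N \near \oo, - (eps / 2) <= b theta N.
  (* At the endpoints all phases are integers and the average is nonnegative; inside, no frequency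
     [i - j + theta] or [i - j - theta] vanishes. *)
  have [th_int|th_fract] : theta \is a Num.int \/ 0 < theta < 1.
    move: th01 => /andP[]; rewrite le_eqVlt => /predU1P[<- _|th0]; first by left; rewrite rpred0.
    by rewrite le_eqVlt => /predU1P[->|th1]; [left; rewrite rpred1|right; rewrite th0].
  - apply: nearW => N; rewrite (@le_trans _ _ 0)//; first by rewrite oppr_le0 divr_ge0 ?ltW.
    apply: avg_ge0 => // n; rewrite mulr_ge0//.
    have /intrP[k ->] := th_int.
    by rewrite -intrM -[_%:~R]add0r ecos_addz ecos0.
  (* By [dist_ecos_le] this expression is a lower bound for [b theta N]; its limit
     [- (eps / 8 + C / M)] is at least [- (eps / 4)]. *)
  have lim : avg w (fun n => kappa M n * ecos (theta * u n)) N
      - (eps / 8 * a N + C * (a N - avg w (fun n => kappa M n * ecos (u n)) N)) @[N --> \oo] -->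
      (0 - (eps / 8 * 1 + C * (1 - (1 - M%:R^-1))) : R).
    apply: cvgB; first exact: cvg_avg_fejer_fract.
    apply: cvgD; first exact: cvgMr.
    by apply: cvgMr; apply: cvgB => //; exact: cvg_avg_fejer1.
  have : \forall N \near \oo, - (eps / 2) < avg w (fun n => kappa M n * ecos (theta * u n)) N
      - (eps / 8 * a N + C * (a N - avg w (fun n => kappa M n * ecos (u n)) N)).
    by apply: (cvgr_gt _ lim); lra.
  apply: filterS => N h; rewrite (le_trans (ltW h))//.
  rewrite /a -avgB -!avgZ -avgD -avgB; apply: le_avg => // n.
  have fl := floor_itv (s n); rewrite intrD in fl.
  have := CP theta (u n) (Num.floor (s n))%:~R th01.
  have -> : ecos (u n - (Num.floor (s n))%:~R) = ecos (u n).
    by rewrite -mulrNz ecos_addz.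
  have d : `|u n - (Num.floor (s n))%:~R| <= 2^-1.
    by rewrite ler_norml /u; lra.
  move=> /(_ d); rewrite ler_norml => /andP[_ h2].
  have := ler_wpM2l (kappa_ge0 n) h2; lra.
near=> N.
have aN : 2^-1 < a N by near: N.
rewrite (cE N (fun n => ecos (theta * (Num.floor (s n))%:~R)) aN) -/(b theta N).
have bN : - (eps / 2) <= b theta N by near: N.
(* Dividing by [a N > 1 / 2] at most doubles the loss [eps / 2]. *)
rewrite ler_pdivlMr; last by rewrite (lt_trans _ aN)// invr_gt0.
rewrite (le_trans _ bN)// mulNr lerN2; nra.
Unshelve. all: by end_near. Qed.

End IntegerParts.

(* MathComp world. The function [a] is considered on the half line (u, +oo)
   only: its values outside are arbitrary, whence the condition [u < n%:R]. *)
Theorem theoremC (R : realType) (u : R) (a : R -> R)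
  (a_hardy : hardy_union a)
  (a_growth : polynomial_growth a)
  (a_far : forall (p : {poly int}) (c : R),
     `|a x - c * (map_poly (intr : int -> R) p).[x]| @[x --> +oo] --> +oo)
  (L : set int) (L_dense : (0 < upper_density R L)%E) :
  exists x y : int, [/\ L x, L y &
    exists n : nat, [/\ (0 < n)%N, u < n%:R,
      Num.floor (a n%:R) <> 0 & y - x = Num.floor (a n%:R)]].
Proof.
have [d [sg [N0 [sg2 s_diff]]]] := hardy_sequence a_hardy a_growth.
(* With [p = 0] and [c = 0], [a_far] says that [a] is unbounded in modulus; 2 suffices to exclude
   the integer part 0. *)
have [X XP] : exists X, forall x, X < x -> 2 <= `|a x|.
  apply/pinftyP; move/cvgryPge : (a_far 0 0) => /(_ 2).
  by apply: filterS => x; rewrite mul0r subr0.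
(* Shifting the sequence by [n0] makes every index positive and past all the thresholds at once. *)
pose n0 := (maxn N0 (maxn (Num.bound u) (Num.bound X))).+1.
have n0P (m n : nat) : (m <= maxn N0 (maxn (Num.bound u) (Num.bound X)))%N -> (m <= n + n0)%N.
  by move=> /leq_trans; apply; rewrite /n0 addnS ltnW// ltnS leq_addl.
have [|s0 s_mono] := s_diff n0; first by rewrite -[n0]add0n n0P// leq_maxl.
have [w w_wt s_mean_zero] := hardy_equidistribution a_far sg2 s0 s_mono.
have [x [y [n [Lx Ly yx]]]] :=
  @intersective_of_averages R L (fun n => Num.floor (a (n + n0)%N%:R)) L_dense
    (averages_of_floor w_wt s_mean_zero).
exists x, y; split => //; exists (n + n0)%N; split => //.
- by rewrite /n0 addnS.
- rewrite (lt_le_trans (unstable.ltr_bound u))// ler_nat n0P//.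
  by rewrite !leq_max leqnn orbT.
- move=> fl0; have := floor_itv (a (n + n0)%N%:R); rewrite fl0 add0r => /andP[a0 a1].
  have := XP (n + n0)%N%:R; rewrite (lt_le_trans (unstable.ltr_bound X)); last first.
    by rewrite ler_nat n0P// !leq_max leqnn !orbT.
  by move=> /(_ isT); rewrite ger0_norm// leNgt (lt_trans a1)// ltr1n.
Qed.
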